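(* Let $g:M\to\mathbb{R}$ be a continuous convex function on a Riemannian manifold $M$ (possibly infinite-dimensional). Then $g$ is subdifferentiable at every point of $M$.
   Context: A Riemannian manifold is a $C^\infty$ manifold modelled on a Hilbert space (possibly infinite-dimensional) with a $C^\infty$ assignment of scalar products on the tangent spaces inducing equivalent norms. A function $g:M\to\mathbb{R}$ is convex if $g\circ\sigma:I\subseteq\mathbb{R}\to\mathbb{R}$ is convex for every geodesic $\sigma:I\to M$ (parameterized by arc length). $g$ is subdifferentiable at $p$ if there exists $\varphi\in C^1(M,\mathbb{R})$ such that $g-\varphi$ attains a local minimum at $p$. *)

(* Defs.v *)
From HB Require Import structures.
From mathcomp Require Import all_boot all_order all_algebra sesquilinear.
From mathcomp Require Import all_classical all_reals all_analysis.
Import numFieldNormedType.Exports.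
Import Order.TTheory GRing.Theory Num.Theory.

Set Implicit Arguments.
Unset Strict Implicit.
Unset Printing Implicit Defensive.

Local Open Scope classical_set_scope.
Local Open Scope ring_scope.

Section ContinuousLinearMaps.
Context {R : realType} {V W : normedModType R}.

Definition continuous_linear : {pred V -> W} :=
  mem [set f : V -> W | linear f /\ continuous f].

Lemma continuous_linear_submod_closed : submod_closed continuous_linear.
Proof.
split=> [|a f g]; rewrite !inE /=.
  split=> [k x y|x]; last exact: cvg_cst.
  by rewrite -[0]/(cst 0) /= scaler0 addr0.
move=> [lf cf] [lg cg]; split=> [k x y|x].
  rewrite -![(a *: f + g) _]/(a *: f _ + g _) lf lg.
  by rewrite !scalerDr !scalerA mulrC addrACA.
by apply: cvgD; [apply: cvgZr; exact: cf | exact: cg].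
Qed.

HB.instance Definition _ := GRing.isSubmodClosed.Build _ _ continuous_linear
  continuous_linear_submod_closed.

Record contlin := Contlin {
  contlin_fun :> V -> W ;
  contlinP : contlin_fun \in continuous_linear }.

HB.instance Definition _ := [isSub for contlin_fun].
HB.instance Definition _ := [Choice of contlin by <:].
HB.instance Definition _ := [SubChoice_isSubLmodule of contlin by <:].

End ContinuousLinearMaps.

Arguments contlin {R} V W.
Notation "''L' ( V , W )" := (contlin V W)
  (at level 8, format "''L' ( V ,  W )") : type_scope.

Section OperatorNorm.
Context {R : realType} {V W : normedModType R}.
Implicit Types f g : 'L(V, W).

Lemma contlin_ext f g : f =1 g -> f = g.
Proof. by move=> fg; apply/val_inj/funext. Qed.

Lemma contlinDE f g x : (f + g) x = f x + g x. Proof. by []. Qed.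

Lemma contlinZE (a : R) f x : (a *: f) x = a *: f x. Proof. by []. Qed.

Lemma contlin_linear f : linear f.
Proof. by have := contlinP f; rewrite inE => -[]. Qed.

Lemma contlin_continuous f : continuous f.
Proof. by have := contlinP f; rewrite inE => -[]. Qed.

HB.instance Definition _ f :=
  GRing.isLinear.Build R V W *:%R f (@contlin_linear f).

Definition opnorm f : R := sup [set `|f x| | x in [set x | `|x| <= 1]].

Lemma contlin_bounded f : exists2 M, 0 <= M & forall x, `|f x| <= M * `|x|.
Proof.
have /(continuous_linear_bounded 0)/linear_boundedP/pinfty_ex_gt0 [M M0 fM] :
    {for 0, continuous f}.
  exact: contlin_continuous.
by exists M => //; exact: ltW.
Qed.

Lemma opnorm_has_sup f : has_sup [set `|f x| | x in [set x | `|x| <= 1]].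
Proof.
split; first by exists `|f 0|, 0 => //=; rewrite normr0.
have [M M0 fM] := contlin_bounded f; exists M => _ /= [x x1 <-].
by rewrite (le_trans (fM x))// ler_piMr.
Qed.

Lemma opnorm_ge0 f : 0 <= opnorm f.
Proof.
apply: le_trans (ub_le_sup (opnorm_has_sup f).2 _); last first.
  by exists 0 => //=; rewrite normr0.
by [].
Qed.

Lemma le_opnorm f x : `|f x| <= opnorm f * `|x|.
Proof.
have [->|x0] := eqVneq x 0; first by rewrite linear0 !normr0 mulr0.
rewrite -ler_pdivrMr ?normr_gt0//.
apply: (ub_le_sup (opnorm_has_sup f).2); exists (`|x|^-1 *: x) => /=.
  by rewrite normrZ normfV normr_id mulVf// normr_eq0.
by rewrite linearZ/= normrZ normfV normr_id mulrC.
Qed.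

Lemma opnorm_le f M : 0 <= M -> (forall x, `|f x| <= M * `|x|) -> opnorm f <= M.
Proof.
move=> M0 fM; apply: ge_sup; first by have [] := opnorm_has_sup f.
by move=> _ [x /= x1 <-]; rewrite (le_trans (fM x))// ler_piMr.
Qed.

Lemma opnormD f g : opnorm (f + g) <= opnorm f + opnorm g.
Proof.
apply: opnorm_le => [|x]; first by rewrite addr_ge0// opnorm_ge0.
by rewrite contlinDE mulrDl (le_trans (ler_normD _ _))// lerD// le_opnorm.
Qed.

Lemma opnormZ_le (a : R) f : opnorm (a *: f) <= `|a| * opnorm f.
Proof.
apply: opnorm_le => [|x]; first by rewrite mulr_ge0// opnorm_ge0.
by rewrite contlinZE normrZ -mulrA ler_wpM2l// le_opnorm.
Qed.

Lemma opnormZ (a : R) f : opnorm (a *: f) = `|a| * opnorm f.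
Proof.
apply/eqP; rewrite eq_le opnormZ_le /=.
have [->|a0] := eqVneq a 0; first by rewrite normr0 mul0r opnorm_ge0.
rewrite -ler_pdivlMl ?normr_gt0// -normfV.
by have := opnormZ_le a^-1 (a *: f); rewrite scalerA mulVf// scale1r.
Qed.

Lemma opnorm0_eq0 f : opnorm f = 0 -> f = 0.
Proof.
move=> f0; apply: contlin_ext => x; apply/normr0_eq0/le_anti.
by rewrite normr_ge0 andbT (le_trans (le_opnorm f x))// f0 mul0r.
Qed.

HB.instance Definition _ := @Lmodule_isNormed.Build R 'L(V, W) opnorm
  opnormD opnormZ opnorm0_eq0.

End OperatorNorm.

Section Ck.
Context {R : realType} {V : normedModType R}.

(* Derivatives are Frechet derivatives, and each iterated derivative takes its
   values in a space of continuous linear maps with the operator norm. *)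
Fixpoint Ck (k : nat) {W : normedModType R} (U : set V) (f : V -> W) : Prop :=
  if k is k'.+1 then
    exists f' : V -> 'L(V, W),
      (forall x, U x -> is_diff x f (f' x)) /\ Ck k' U f'
  else forall x, U x -> {for x, continuous f}.

Definition Csmooth {W : normedModType R} (U : set V) (f : V -> W) : Prop :=
  forall k, Ck k U f.

End Ck.

Definition hilbert_space {R : realType} (H : completeNormedModType R) : Prop :=
  exists dot : {dot H for idfun}, forall x : H, `|x| ^+ 2 = dot x x.

Section Manifolds.
Context {R : realType} (H : completeNormedModType R) (M : topologicalType).

Record chart := Chart {
  chart_dom : set M ;
  chart_map :> M -> H ;
  chart_inv : H -> M ;
  chart_dom_open : open chart_dom ;
  chart_codom_open : open (chart_map @` chart_dom) ;
  chart_mapK : {in chart_dom, cancel chart_map chart_inv} ;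
  chart_map_continuous : forall q, chart_dom q ->
    {for q, continuous chart_map} ;
  chart_inv_continuous : forall x, (chart_map @` chart_dom) x ->
    {for x, continuous chart_inv}
}.

Definition chart_codom (a : chart) : set H := a @` chart_dom a.

Definition chart_transition (a b : chart) : H -> H := b \o chart_inv a.

Definition chart_overlap (a b : chart) : set H :=
  a @` (chart_dom a `&` chart_dom b).

(* A scalar product on the tangent spaces is given by its expression
   [metric a x u v] in each chart [a]; the field [metric_change] says that these
   expressions define the same scalar product on the tangent space. *)
Record riemannian := Riemannian {
  riem_hausdorff : hausdorff_space M ;
  atlas : set chart ;
  atlas_cover : forall q, exists2 a, atlas a & chart_dom a q ;
  atlas_smooth : forall a b, atlas a -> atlas b ->
    Csmooth (chart_overlap a b) (chart_transition a b) ;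
  metric : chart -> H -> 'L(H, 'L(H, R^o)) ;
  metric_smooth : forall a, atlas a -> Csmooth (chart_codom a) (metric a) ;
  metric_sym : forall a, atlas a -> forall x, chart_codom a x ->
    forall u v, metric a x u v = metric a x v u ;
  metric_equiv : forall a, atlas a -> forall x, chart_codom a x ->
    exists c C : R, [/\ 0 < c, 0 < C &
      forall v, c * `|v| ^+ 2 <= metric a x v v <= C * `|v| ^+ 2] ;
  metric_change : forall a b, atlas a -> atlas b ->
    forall x, chart_overlap a b x -> forall u v,
      metric a x u v = metric b (chart_transition a b x)
        ('d (chart_transition a b) x u) ('d (chart_transition a b) x v)
}.

End Manifolds.

Section Geodesics.
Context {R : realType} {H : completeNormedModType R} {M : topologicalType}.
Variable X : riemannian H M.

(* [z] is the value at [(u, v)] of the Christoffel symbol, at [x], of the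
   Levi-Civita connection of [G]; it is characterized by the Koszul formula,
   and it exists and is unique by the Riesz theorem. *)
Definition christoffel (G : H -> 'L(H, 'L(H, R^o))) (x u v z : H) : Prop :=
  forall w, G x z w =
    2^-1 * (('d G x u : 'L(H, 'L(H, R^o))) v w
          + ('d G x v : 'L(H, 'L(H, R^o))) u w
          - ('d G x w : 'L(H, 'L(H, R^o))) u v).

Definition derivative_within (I : set R) (c : R -> H) (t : R) (v : H) : Prop :=
  (s - t)^-1 *: (c s - c t) @[s --> within I t^'] --> v.

(* Geodesics parametrized by arc length: solutions of
   [c'' + Gamma_c(c', c') = 0] with [c'] of norm 1. As this equation is
   invariant under changes of charts, one chart around each point is enough. *)
Definition geodesic (I : set R) (sigma : R -> M) : Prop :=
  forall t, I t -> exists2 a, atlas X a & exists c1 c2 : R -> H,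
    \forall s \near within I (nbhs t),
      [/\ chart_dom a (sigma s),
          derivative_within I (a \o sigma) s (c1 s),
          derivative_within I c1 s (c2 s),
          christoffel (metric X a) (a (sigma s)) (c1 s) (c1 s) (- c2 s) &
          metric X a (a (sigma s)) (c1 s) (c1 s) = 1].

Definition geodesically_convex (g : M -> R) : Prop :=
  forall (I : set R) (sigma : R -> M), is_interval I -> geodesic I sigma ->
    convex_function (I : set R^o) (g \o sigma).

Definition C1_function (phi : M -> R) : Prop :=
  forall a, atlas X a -> Ck 1 (chart_codom a) ((phi \o chart_inv a) : H -> R^o).

Definition subdifferentiable (g : M -> R) (p : M) : Prop :=
  exists2 phi : M -> R, C1_function phi &
    \forall q \near p, g p - phi p <= g q - phi q.

End Geodesics.

(* Main.v *)
Require Import Defs.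
From HB Require Import structures.
From mathcomp Require Import all_boot all_order all_algebra.
From mathcomp Require Import all_classical all_reals all_analysis.
From mathcomp Require Import sesquilinear ring lra.
Import numFieldNormedType.Exports.
Import Order.TTheory GRing.Theory Num.Theory.

Set Implicit Arguments.
Unset Strict Implicit.
Unset Printing Implicit Defensive.

Local Open Scope classical_set_scope.
Local Open Scope ring_scope.

(** In a chart [a] around [p], unit speed geodesics exist for a uniform time
   from every point near [a p] and in every direction, and they deviate from
   straight lines by [O(t^2)]. Convexity along them makes [f = g o a^-1] locally
   Lipschitz, and then [f + K |x - a p|^2] convex near [a p] for some [K]; hence
   [f (a p + v) >= f (a p) + l v - K |v|^2] for a continuous linear form [l].
   A [C^1] function [psi] with support in a small ball around [a p] and with
   [psi (a p + v) <= psi (a p) + l v - K |v|^2] then transports to a function on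
   [M] that touches [g] from below at [p]. *)

(** * Calculus in normed spaces *)

(** Infinite dimension shapes the proof. Balls are not compact, so local bounds on the metric and on
    [g] come from continuity at the single point [a p]. A closed ball of a chart need not be closed
    in [M], even though [M] is Hausdorff, so extending the transported function by zero takes the
    length argument of [chart_separation]. Joining two given points by a geodesic would call for the
    exponential map and the inverse function theorem. Only the initial value problem is solved here;
    the [O(t^2)] deviation makes up for the missed end points. If the deviation is at most [N t^2]
    and [f] is [L]-Lipschitz, convexity along geodesics becomes semiconvexity along segments with
    constant [L N]. One minimization, [coercive_sublinear_minorant], uses completeness three times:
    it yields the Riesz theorem, hence the Christoffel symbols and the antiderivatives of curves,
    and it yields the linear form [l], in place of the Hahn-Banach theorem. *)

Section Calculus.
Context {R : realType}.
Implicit Types V W : normedModType R.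

Lemma is_diff_near V W (f L : V -> W) x : is_diff x f L ->
  forall e, 0 < e ->
    \forall h \near (0 : V), `|f (h + x) - f x - L h| <= e * `|h|.
Proof.
move=> [/diff_locallyP[_ fE] dfE] e e0.
move: fE => /eqaddoP/(_ e e0); apply: filterS => h /=.
by rewrite -dfE opprD addrA.
Qed.

Lemma is_diff_intro V W (f L : V -> W) x : linear L -> continuous L ->
  (forall e, 0 < e ->
    \forall h \near (0 : V), `|f (h + x) - f x - L h| <= e * `|h|) ->
  is_diff x f L.
Proof.
move=> linL cL fL.
pose lM := GRing.isLinear.Build _ _ _ _ _ linL.
pose l : {linear V -> W} := HB.pack L lM.
have fE : f \o shift x = cst (f x) + l +o_ 0 id.
  apply/eqaddoP => e e0; apply: filterS (fL e e0) => h /=.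
  by rewrite -[X in _ -> `|X| <= _]/(f (h + x) - (f x + L h)) opprD addrA.
have dE : 'd f x = L :> (V -> W) by apply: (@diff_unique _ _ _ f l).
by split => //; apply/diff_locallyP; split; rewrite dE.
Qed.

Lemma is_derive1_diff W (c : R -> W) (t : R) v :
  is_derive t 1 c v <-> is_diff t c (fun h : R => h *: v).
Proof.
split=> [[dc <-]|[dc cE]].
  have dct : differentiable c t by apply/derivable1_diffP.
  by split => //; rewrite diff1E// derive1E.
split; first exact/derivable1_diffP.
by rewrite deriveE// cE scale1r.
Qed.

Lemma is_derive1_comp V W (f : V -> W) (L : V -> W) (c : R -> V) (t : R) v :
  is_diff (c t) f L -> is_derive t 1 c v -> is_derive t 1 (f \o c) (L v).
Proof.
move=> fL cv; have linL u w : L (u *: w) = u *: L w.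
  by case: fL => _ <-; rewrite linearZ.
apply/is_derive1_diff; have /is_derive1_diff cv' := cv.
have := is_diff_comp cv' fL.
by congr is_diff_def; apply/funext => h /=; rewrite linL.
Qed.

Lemma is_diff_contlin V W (f : 'L(V, W)) x : is_diff x f f.
Proof.
split; first exact/linear_differentiable/contlin_continuous.
exact/diff_lin/contlin_continuous.
Qed.

(** Evaluation gets a name so that it can carry the bilinear structure from which [is_derive1_apply]
    draws the product rule. *)
Definition contlin_apply V W (f : 'L(V, W)) (x : V) : W := f x.

Lemma contlin_apply_bilinear V W :
  bilinear_for *:%R *:%R (@contlin_apply V W).
Proof. by split=> [x a f g|f a x y] //=; rewrite /contlin_apply linearP. Qed.

HB.instance Definition _ V W := @bilinear_isBilinear.Build _ _ _ _ _ _
  (@contlin_apply V W) (@contlin_apply_bilinear V W).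

Lemma ler_contlin V W (f : 'L(V, W)) x : `|f x| <= `|f| * `|x|.
Proof. exact: le_opnorm. Qed.

Lemma contlin_norm_le V W (f : 'L(V, W)) M :
  0 <= M -> (forall x, `|f x| <= M * `|x|) -> `|f| <= M.
Proof. exact: opnorm_le. Qed.

Lemma contlinBE V W (f g : 'L(V, W)) x : (f - g) x = f x - g x.
Proof. by []. Qed.

Lemma contlin_apply_continuous V W :
  continuous (fun p : 'L(V, W) * V => contlin_apply p.1 p.2).
Proof.
move=> [A v]; apply/cvgrPdist_le => e e0 /=.
have k0 : 0 < `|A| + `|v| + 1 by rewrite ltr_wpDl// addr_ge0.
have d0 : 0 < Num.min 1 (e / (`|A| + `|v| + 1)) by rewrite lt_min ltr01 divr_gt0.
have := nbhsx_ballx (A, v) _ d0; apply: filterS => -[B w] [/=].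
rewrite -!ball_normE/= !lt_min => /andP[_ AB] /andP[vw1 vw].
have -> : contlin_apply A v - contlin_apply B w = (A - B) w + A (v - w).
  by rewrite /contlin_apply contlinBE linearB/= [RHS]addrC subrKA.
rewrite (le_trans (ler_normD _ _))//.
have w1 : `|w| <= `|v| + 1.
  rewrite -lerBlDl (le_trans (lerB_dist _ _))// distrC ltW//.
have h1 : `|(A - B) w| <= e / (`|A| + `|v| + 1) * (`|v| + 1).
  by rewrite (le_trans (ler_contlin _ _))// ler_pM// ltW.
have h2 : `|A (v - w)| <= `|A| * (e / (`|A| + `|v| + 1)).
  by rewrite (le_trans (ler_contlin _ _))// ler_wpM2l// ltW.
rewrite (le_trans (lerD h1 h2))// mulrC -mulrDl mulrC.
by rewrite (addrC _ `|A|) addrA divfK// gt_eqF.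
Qed.

Lemma is_derive1_apply V W (A : R -> 'L(V, W)) (v : R -> V) (t : R) A' v' :
  is_derive t 1 A A' -> is_derive t 1 v v' ->
  is_derive t 1 (fun s => A s (v s)) (A' (v t) + A t v').
Proof.
move=> /is_derive1_diff dA /is_derive1_diff dv.
pose ev (p : 'L(V, W) * V) := contlin_apply p.1 p.2.
have dev : is_diff (A t, v t) ev
    (fun q => contlin_apply (A t) q.2 + contlin_apply q.1 (v t)).
  have c := @contlin_apply_continuous V W.
  by split; [exact: differentiable_bilin|exact: diff_bilin].
have dAv : is_derive t 1 (fun s => (A s, v s)) (A', v').
  by apply/is_derive1_diff; apply: is_diff_pair.
rewrite addrC; exact: (is_derive1_comp (c := fun s => (A s, v s)) dev dAv).
Qed.

Lemma is_derive1_contlin V W (f : 'L(V, W)) (c : R -> V) (t : R) v :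
  is_derive t 1 c v -> is_derive t 1 (f \o c) (f v).
Proof. by apply: is_derive1_comp; exact: is_diff_contlin. Qed.

Lemma is_derive1_continuous W (c : R -> W) (t : R) v :
  is_derive t 1 c v -> {for t, continuous c}.
Proof. by move=> [/derivable1_diffP/differentiable_continuous]. Qed.

Lemma is_derive1_within_continuous W (c c' : R -> W) (a b : R) :
  (forall t, a <= t <= b -> is_derive t 1 c (c' t)) ->
  {within `[a, b], continuous c}.
Proof.
move=> dc; apply: derivable_within_continuous => t; rewrite in_itv/= => tab.
by case: (dc t tab).
Qed.

(* The mean value inequality, as a property of the target space: it passes from
   [W] to ['L(V, W)] by evaluation. *)
Definition mean_value_space W := forall (c c' : R -> W) (a b M : R), a <= b ->
  (forall t, a <= t <= b -> is_derive t 1 c (c' t)) ->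
  (forall t, a <= t <= b -> `|c' t| <= M) -> `|c b - c a| <= M * (b - a).

Lemma mean_value_space_real : mean_value_space R^o.
Proof.
move=> c c' a b M ab dc cM.
have [] := @MVT_segment _ (c : R -> R) c' a b ab _ _.
- by move=> x /subset_itv_oo_cc; rewrite in_itv/= => /dc.
- exact: is_derive1_within_continuous dc.
move=> x; rewrite in_itv/= => /cM xM /= ->; rewrite normrM.
rewrite [X in _ * X]ger0_norm ?subr_ge0//.
by rewrite ler_wpM2r// subr_ge0.
Qed.

Lemma mean_value_space_contlin V W :
  mean_value_space W -> mean_value_space 'L(V, W).
Proof.
move=> mW c c' a b M ab dc cM.
have M0 : 0 <= M by rewrite (le_trans _ (cM a _))// lexx ab.
apply: contlin_norm_le => [|v]; first by rewrite mulr_ge0// subr_ge0.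
rewrite contlinBE mulrAC; apply: (mW (fun t => c t v) (fun t => c' t v)) => // t tab.
- have := is_derive1_apply (dc t tab) (@is_derive_cst _ _ _ v t 1).
  by rewrite linear0 addr0.
- by rewrite (le_trans (ler_contlin _ _))// ler_wpM2r// cM.
Qed.

Lemma is_derive1_affine V (y v : V) (t : R) :
  is_derive t 1 (fun s => y + s *: v) v.
Proof.
apply/is_derive1_diff.
have := is_diffD (is_diff_cst y t) (is_diff_scalel t v).
by congr is_diff_def; rewrite add0r.
Qed.

Lemma ball_segment V (x0 x y : V) r (t : R) : ball x0 r x -> ball x0 r y ->
  0 <= t <= 1 -> ball x0 r (y + t *: (x - y)).
Proof.
rewrite -ball_normE/= => x0x x0y /andP[t0 t1].
have -> : x0 - (y + t *: (x - y)) = t *: (x0 - x) + (1 - t) *: (x0 - y).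
  rewrite scalerBl scale1r addrCA -scalerBr opprD addrA -scalerN opprB.
  by congr (_ + _ *: _); rewrite opprB [RHS]addrC subrKA.
rewrite (le_lt_trans (ler_normD _ _))// !normrZ (ger0_norm t0) ger0_norm ?subr_ge0//.
have [->|tN0] := eqVneq t 0; first by rewrite mul0r add0r subr0 mul1r.
have tgt0 : 0 < t by rewrite lt_def tN0.
have h1 : t * `|x0 - x| < t * r by rewrite ltr_pM2l.
have h2 : (1 - t) * `|x0 - y| <= (1 - t) * r by rewrite ler_wpM2l ?subr_ge0// ltW.
lra.
Qed.

Lemma mean_value_ball V W (f : V -> W) (f' : V -> 'L(V, W)) x0 r M :
  mean_value_space W ->
  (forall x, ball x0 r x -> is_diff x f (f' x)) ->
  (forall x, ball x0 r x -> `|f' x| <= M) ->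
  forall x y, ball x0 r x -> ball x0 r y -> `|f x - f y| <= M * `|x - y|.
Proof.
move=> mW df fM x y x0x x0y.
have := mW (fun t => f (y + t *: (x - y)))
  (fun t => f' (y + t *: (x - y)) (x - y)) 0 1 (M * `|x - y|) ler01.
rewrite scale1r scale0r addr0 [y + _]addrC subrK subr0 mulr1.
apply => t /(ball_segment x0x x0y) tx.
  apply: (is_derive1_comp (c := fun t => y + t *: (x - y))); first exact: df.
  exact: is_derive1_affine.
by rewrite (le_trans (ler_contlin _ _))// ler_wpM2r// fM.
Qed.

Lemma cauchy_cvg_dist (E : completeNormedModType R) (u : nat -> E) :
  (forall e, 0 < e -> exists N, forall n, (N <= n)%N -> `|u N - u n| < e) ->
  exists l : E, u @ \oo --> l.
Proof.
move=> uC; apply/cvg_ex; apply/cauchy_cvgP; apply: cauchy_exP => e e0.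
have [N uN] := uC e e0; exists (u N); exists N => // n /= Nn.
by rewrite -ball_normE/=; exact: uN.
Qed.

Lemma invS_lt (e : R) : 0 < e -> \forall n \near \oo, n.+1%:R^-1 < e.
Proof. by move=> e0; exact: (near_infty_natSinv_lt (PosNum e0)). Qed.

(** * Minimization for coercive bilinear forms, and the Riesz theorem *)

Section CoerciveForm.
Context {H : completeNormedModType R} (B : 'L(H, 'L(H, R^o))) (c : R).
Hypotheses (c0 : 0 < c) (Bsym : forall u v, B u v = B v u)
  (Bcoercive : forall v, c * `|v| ^+ 2 <= B v v).

(** The values are read in [R] instead of [R^o], for the sake of the arithmetic tactics. *)
Let b (u v : H) : R := B u v.

Let bsym (u v : H) : b u v = b v u. Proof. exact: Bsym. Qed.

Let bcoercive (v : H) : c * `|v| ^+ 2 <= b v v. Proof. exact: Bcoercive. Qed.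

Let BD (u v w : H) : b (u + v) w = b u w + b v w.
Proof. by rewrite /b linearD. Qed.

Let BZ (a : R) (u w : H) : b (a *: u) w = a * b u w.
Proof. by rewrite /b linearZ. Qed.

Let BDr (u v w : H) : b w (u + v) = b w u + b w v.
Proof. by rewrite /b linearD. Qed.

Let BZr (a : R) (u w : H) : b w (a *: u) = a * b w u.
Proof. by rewrite /b linearZ. Qed.

Let BN (u w : H) : b (- u) w = - b u w.
Proof. by rewrite /b linearN. Qed.

Let BNr (u w : H) : b w (- u) = - b w u.
Proof. by rewrite /b linearN. Qed.

Let B_ge0 v : 0 <= b v v.
Proof. by rewrite (le_trans _ (bcoercive v))// mulr_ge0// ?ltW// exprn_ge0. Qed.

Let B_le u v : - (`|B u| * `|v|) <= b u v.
Proof. by have := ler_contlin (B u) v; rewrite -/(b u v) ler_norml => /andP[]. Qed.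

(* [- z] is a subgradient of [p] at the origin; [z] is the minimizer of the
   strongly convex functional [v |-> b v v / 2 + p v]. *)
Lemma coercive_sublinear_minorant (p : H -> R) (L : R) :
  (forall u v, p (u + v) <= p u + p v) ->
  (forall t u, 0 < t -> p (t *: u) = t * p u) ->
  (forall u, p u <= L * `|u|) ->
  exists z, forall w, - B z w <= p w.
Proof.
move=> pD pZ pL.
have p0 : p 0 = 0 by have := pZ 2 0 (@ltr0Sn R 1); rewrite scaler0; lra.
have pge u : - (L * `|u|) <= p u.
  by have := pD u (- u); have := pL (- u); rewrite subrr p0 normrN; lra.
have L0 (u : H) : 0 <= L * `|u| by have := pge u; have := pL u; lra.
pose J v : R := 2^-1 * b v v + p v.
pose S : set R := [set J v | v in [set: H]].
have S_inf : has_inf S.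
  split; first by exists (J 0), 0.
  exists (- (L ^+ 2 / (2 * c))) => _ [v _ <-]; rewrite /J.
  have := pge v; have := bcoercive v.
  suff : - (L ^+ 2 / (2 * c)) <= 2^-1 * (c * `|v| ^+ 2) - L * `|v| by lra.
  rewrite lerNl ler_pdivlMr ?mulr_gt0//.
  have := sqr_ge0 (c * `|v| - L); rewrite sqrrB expr2 => h.
  nra.
have inf_le v : inf S <= J v by apply: (ge_inf S_inf.2); exists v.
have /choice[v Jv] n : exists v, J v < inf S + n.+1%:R^-1.
  have [|_ [v _ <-] Jv] := @inf_adherent _ S n.+1%:R^-1 _ S_inf.
    by rewrite invr_gt0.
  by exists v.
(* Minimizing sequences are Cauchy: [J] is at least [inf S] at the midpoint, where the parallelogram
   identity gains a quarter of [b] at the difference. *)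
have vC n k : c * `|v n - v k| ^+ 2 <= 4 * (n.+1%:R^-1 + k.+1%:R^-1).
  have := Jv n; have := Jv k; have := inf_le (2^-1 *: (v n + v k)).
  have := bcoercive (v n - v k); have := pD (v n) (v k).
  rewrite /J pZ ?invr_gt0// !(BD, BZ, BDr, BZr, BN, BNr) (bsym (v k) (v n)).
  move: (n.+1%:R^-1) (k.+1%:R^-1) => e1 e2.
  lra.
have [z vz] : exists z : H, v @ \oo --> z.
  apply: cauchy_cvg_dist => e e0.
  have /invS_lt[N _ Ne] : 0 < c * e ^+ 2 / 8 by rewrite divr_gt0// mulr_gt0// exprn_gt0.
  exists N => n Nn; rewrite -(@ltr_pXn2r _ 2)// ?nnegrE// ?ltW//.
  rewrite -(ltr_pM2l c0) (le_lt_trans (vC _ _))//.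
  have : n.+1%:R^-1 <= N.+1%:R^-1 :> R by rewrite lef_pV2 ?posrE// ler_nat.
  have /= := Ne N (leqnn N).
  by move: (n.+1%:R^-1) (N.+1%:R^-1) => e1 e2; lra.
(* The value of [p] at the limit is controlled by subadditivity: [p z - p (v n)] is at most
   [p (z - v n)], hence at most [L] times the distance. *)
have Jz : J z <= inf S.
  have Jzv n : J z <= J (v n) + (`|B z| + `|L|) * `|z - v n|.
    have := B_ge0 (v n - z); have := B_le z (v n - z).
    have := pD (v n) (z - v n); have := pL (z - v n).
    rewrite [v n + _]addrC subrK distrC /J !(BD, BZ, BDr, BZr, BN, BNr).
    have : L * `|v n - z| <= `|L| * `|v n - z| by rewrite ler_wpM2r// ler_norm.
    rewrite (bsym (v n) z); lra.
  apply/ler_addgt0Pr => e e0.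
  have K0 : 0 < `|B z| + `|L| + 1 by rewrite ltr_wpDl// addr_ge0.
  have d0 : 0 < e / 2 / (`|B z| + `|L| + 1) by rewrite !divr_gt0.
  move/cvgrPdist_lt/(_ _ d0) : vz => vz.
  have e20 : 0 < e / 2 by rewrite divr_gt0.
  have [N _ /(_ N (leqnn N))/= [vzN Ne]] := filterI vz (invS_lt e20).
  have := Jzv N; have := Jv N; move: vzN Ne; rewrite ltr_pdivlMr//.
  move: (N.+1%:R^-1) => e1 vzN e1e.
  have : 0 <= `|z - v N| by [].
  nra.
exists z => w; rewrite -/(b z w); apply/ler_addgt0Pr => e e0.
have k0 : 0 < b w w + 1 by rewrite ltr_wpDl.
(* First-order condition at the minimizer: after division by [t], the comparison of [J (z + t w)]
   with [J z] leaves the error [t * b w w / 2], and this [t] keeps it below [e]. *)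
pose t := 2 * e / (b w w + 1).
have t0 : 0 < t by rewrite divr_gt0// mulr_gt0.
have te : 2^-1 * (t * b w w) <= e.
  have -> : 2^-1 * (t * b w w) = e * (b w w / (b w w + 1)).
    by rewrite /t; field; rewrite gt_eqF.
  by rewrite ler_piMr ?(ltW e0)// ler_pdivrMr// mul1r lerDl.
have := inf_le (z + t *: w); have := pD z (t *: w).
move: Jz; rewrite /J pZ// !(BD, BZ, BDr, BZr, BN, BNr) (bsym w z) => Jz h1 h2.
have : 0 <= t * (b z w + p w + 2^-1 * (t * b w w)) by lra.
by rewrite pmulr_rge0//; lra.
Qed.

(** For the linear functional [- l], the minorant inequalities at [w] and [- w] together are an
    equality. *)
Lemma coercive_riesz (l : 'L(H, R^o)) : exists z, forall w, B z w = l w.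
Proof.
have [||u|z zl] := @coercive_sublinear_minorant (fun w => - l w : R) `|l|.
- by move=> u v; rewrite linearD opprD.
- by move=> t u _; rewrite linearZ mulrN.
- by rewrite (le_trans _ (ler_contlin l u))// -normrN ler_norm.
exists z => w; apply/le_anti/andP; split; last by have := zl w; rewrite lerN2.
by have := zl (- w); rewrite !linearN !opprK.
Qed.

End CoerciveForm.

Lemma contlin_of_bounded V W (f : V -> W) M : linear f ->
  (forall x, `|f x| <= M * `|x|) -> exists F : 'L(V, W), forall x, F x = f x.
Proof.
move=> linf fM.
have cf : continuous f.
  move=> x; apply/cvgrPdist_le => e e0; near=> y.
  have -> : f x - f y = f (x - y).
    by have := linf (-1) y x; rewrite !scaleN1r addrC => <-; rewrite addrC.
  have M0 : 0 < `|M| + 1 by rewrite ltr_wpDl.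
  rewrite (le_trans (fM _))// (@le_trans _ _ ((`|M| + 1) * `|x - y|))//.
    by rewrite ler_wpM2r// (le_trans (ler_norm _))// lerDl.
  rewrite -ler_pdivlMl//; near: y; apply: cvgr_dist_le => //.
  by rewrite mulr_gt0// invr_gt0.
have fcl : f \in continuous_linear by rewrite inE.
by exists (Contlin fcl).
Unshelve. all: by end_near. Qed.

(** Cauchy-Schwarz makes the scalar product an element of the space of continuous bilinear forms,
    coercive with constant 1, to which the results above apply. *)
Lemma hilbert_form (H : completeNormedModType R) : hilbert_space H ->
  exists D : 'L(H, 'L(H, R^o)),
    [/\ forall u v, D u v = D v u, forall v, D v v = `|v| ^+ 2 &
      forall u v, `|D u v| <= `|u| * `|v|].
Proof.
move=> [dot dotE].
have dC u v : dot u v = dot v u by rewrite hermC /= expr0 mul1r.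
have dD u v w : dot u (v + w) = dot u v + dot u w by rewrite linearDr.
have dZ a u v : dot u (a *: v) = a * dot u v.
  by rewrite dC linearZl_LR dC.
have dN u v : dot u (- v) = - dot u v by rewrite -scaleN1r dZ mulN1r.
have d0 u : dot u 0 = 0 by rewrite -(scale0r 0) dZ mul0r.
have dge u v : - (`|u| * `|v|) <= dot u v.
  have [->|u0] := eqVneq u 0; first by rewrite dC d0 normr0 mul0r oppr0.
  have [->|v0] := eqVneq v 0; first by rewrite d0 normr0 mulr0 oppr0.
  have uv0 : 0 < `|u| * `|v| by rewrite mulr_gt0 ?normr_gt0.
  (* The square of the norm of [|v| u + |u| v] equals [2 |u| |v| (dot u v + |u| |v|)]. *)
  have := sqr_ge0 `| `|v| *: u + `|u| *: v |; rewrite dotE.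
  rewrite dD !dZ ![dot (_ + _) _]dC !dD !dZ -!dotE (dC v u) => h.
  rewrite -subr_ge0 opprK -(pmulr_rge0 _ uv0); move: h.
  have -> : `|v| * (`|v| * `|u| ^+ 2 + `|u| * dot u v) +
      `|u| * (`|v| * dot u v + `|u| * `|v| ^+ 2) =
      2 * (`|u| * `|v| * (dot u v + `|u| * `|v|)) by ring.
  by rewrite (pmulr_rge0 _ (@ltr0Sn R 1)).
have CS u v : `|dot u v| <= `|u| * `|v|.
  rewrite ler_norml dge/= -lerN2 -dN.
  by have := dge u (- v); rewrite normrN.
have /choice[d dE] u : exists F : 'L(H, R^o), forall x, F x = dot u x.
  apply: (@contlin_of_bounded H R^o (dot u) `|u|); last exact: CS.
  by move=> a x y; rewrite dD dZ.
have [||D DE] := @contlin_of_bounded H 'L(H, R^o) d 1.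
- move=> a x y; apply: contlin_ext => z.
  by rewrite contlinDE contlinZE !dE dC dD dZ !(dC z).
- move=> x; rewrite mul1r; apply: contlin_norm_le => // y.
  by rewrite dE; exact: CS.
by exists D; split=> [u v|v|u v]; rewrite !DE !dE.
Qed.

(** The mean value inequality for [s |-> c s - s *: u]. Both signs of [h] are covered because
    solutions are followed forward and backward in time. *)
Lemma mean_value_center W (c c' : R -> W) (u : W) (t h M : R) :
  mean_value_space W ->
  (forall s, `|s - t| <= `|h| -> is_derive s 1 c (c' s)) ->
  (forall s, `|s - t| <= `|h| -> `|c' s - u| <= M) ->
  `|c (h + t) - c t - h *: u| <= M * `|h|.
Proof.
move=> mW dc cM.
pose k s := c s - s *: u.
have dk s : `|s - t| <= `|h| -> is_derive s 1 k (c' s - u).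
  move=> /dc dcs; have := is_derive1_affine 0 u s => du.
  apply: is_deriveB; move: du; congr is_derive.
  by apply/funext => r; rewrite add0r.
have -> : c (h + t) - c t - h *: u = k (h + t) - k t.
  by rewrite /k scalerDl opprD opprB !addrA subrK addrAC.
have [h0|h0] := leP 0 h.
  have := mW k (fun s => c' s - u) t (h + t) M.
  rewrite addrK (ger0_norm h0); apply; first by rewrite lerDr.
  - move=> s /andP[ts st]; apply: dk; rewrite !ger0_norm ?subr_ge0//.
    by rewrite lerBlDr.
  - move=> s /andP[ts st]; apply: cM; rewrite !ger0_norm ?subr_ge0//.
    by rewrite lerBlDr.
have := mW k (fun s => c' s - u) (h + t) t M.
rewrite distrC (_ : t - (h + t) = - h); last by rewrite opprD addrCA subrr addr0.
rewrite (ltr0_norm h0); apply.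
- by rewrite gerDr ltW.
- move=> s /andP[ts st]; apply: dk; rewrite (ltr0_norm h0) ler0_norm ?subr_le0//.
  by rewrite lerN2 lerBrDr.
- move=> s /andP[ts st]; apply: cM; rewrite (ltr0_norm h0) ler0_norm ?subr_le0//.
  by rewrite lerN2 lerBrDr.
Qed.

Lemma real_antiderivative (f : R -> R) (T : R) : continuous f ->
  exists F : R -> R, forall t : R, `|t| < T -> is_derive t 1 F (f t).
Proof.
move=> cf.
exists (fun x => \int[lebesgue_measure]_(t in `[- T, x]) (f t))%R => t.
rewrite ltr_norml => /andP[Tt tT].
have [|dF F'] := @continuous_FTC1_closed R f (- T) t T tT _ Tt (cf t).
  apply: continuous_compact_integrable; first exact: segment_compact.
  exact: continuous_subspaceT.
by split; [exact: dF|rewrite -derive1E; exact: F'].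
Qed.

(** * Mean values and antiderivatives of curves in a Hilbert space *)

Section HilbertCurves.
Context {H : completeNormedModType R} (D : 'L(H, 'L(H, R^o))).
Hypotheses (Dsym : forall u v, D u v = D v u)
  (Dnorm : forall v, D v v = `|v| ^+ 2)
  (DCS : forall u v, `|D u v| <= `|u| * `|v|).

(** Pairing the curve with its own increment [w] reduces the inequality to the real case, and one
    factor [|w|] cancels. *)
Lemma mean_value_space_hilbert : mean_value_space H.
Proof.
move=> c c' a b M ab dc cM; set w := c b - c a.
have [->|w0] := eqVneq w 0.
  by rewrite normr0 mulr_ge0 ?subr_ge0// (le_trans _ (cM a _))// lexx ab.
have := @mean_value_space_real (D w \o c) (fun t => D w (c' t)) a b (`|w| * M) ab.
rewrite (_ : _ - _ = D w w :> R) /=; last by rewrite -linearB.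
rewrite Dnorm ger0_norm ?exprn_ge0// expr2 -!mulrA.
rewrite ler_pM2l ?normr_gt0//; apply => t tab.
  exact: is_derive1_contlin (dc t tab).
by rewrite (le_trans (DCS _ _))// ler_wpM2l// cM.
Qed.

Lemma riesz (l : 'L(H, R^o)) : exists z, forall w, D z w = l w.
Proof.
by apply: (coercive_riesz (c := 1)) => // v; rewrite mul1r Dnorm.
Qed.

(* The antiderivatives of [t |-> D w (c t)] that vanish at [0] depend linearly and
   continuously on [w], so the Riesz theorem applies to them. *)
Lemma hilbert_antiderivative (c : R -> H) (T : R) : 0 < T -> continuous c ->
  exists2 C : R -> H, C 0 = 0 & forall t : R, `|t| < T -> is_derive t 1 C (c t).
Proof.
move=> T0 cc.
have [K cK] : exists K, forall t, `|t| < T -> `|c t| <= K.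
  have cnc : {within `[- T, T], continuous (fun t => `|c t|)}.
    apply: continuous_subspaceT => t.
    by apply: continuous_comp; [exact: cc|exact: norm_continuous].
  have [|m _ mP] := EVT_max _ cnc; first by rewrite ge0_cp// ltW.
  exists `|c m| => t; rewrite ltr_norml => /andP[Tt tT].
  by apply: mP; rewrite in_itv/= !ltW.
have K0 : 0 <= K by apply: le_trans (cK 0 _); rewrite ?normr0.
have /choice[F FP] (w : H) : exists F : R -> R,
    F 0 = 0 /\ forall t : R, `|t| < T -> is_derive t 1 F (D w (c t)).
  have [|F dF] := @real_antiderivative (D w \o c) T.
    by move=> t; apply: continuous_comp; [exact: cc|exact: contlin_continuous].
  exists (fun t => F t - F 0); split; first by rewrite subrr.
  move=> t /dF dFt; rewrite -[D w _]subr0; apply: is_deriveB; exact: is_derive_cst.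
have F0 w : F w 0 = 0 by case: (FP w).
have dF w (t : R) : `|t| < T -> is_derive t 1 (F w) (D w (c t)).
  by case: (FP w) => _; apply.
have ball0 (h t : R) : `|h| < T -> `|t - 0| <= `|h| -> `|t| < T.
  by rewrite subr0 => hT /le_lt_trans; apply.
(* [F w] is chosen separately for each [w]; linearity holds because two antiderivatives that vanish
   at 0 coincide. *)
have Flin (t : R) : `|t| < T -> linear ((fun w => F w t) : H -> R^o).
  move=> tT a v w; apply/eqP; rewrite -subr_eq0 -normr_le0.
  have := @mean_value_center R^o (fun s => F (a *: v + w) s - (a *: F v s + F w s))
   (fun s => D (a *: v + w) (c s) - (a *: D v (c s) + D w (c s))) 0 0 t 0
     mean_value_space_real.
  rewrite addr0 !F0 scaler0 addr0 !subr0 scaler0 subr0 mul0r; apply.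
  - move=> s /(ball0 _ _ tT) sT; apply: is_deriveB; first exact: dF.
    by apply: is_deriveD; [apply: is_deriveZ|]; exact: dF.
  - by move=> s _; rewrite linearP subrr subr0 normr0.
have Fbound (t : R) w : `|t| < T -> `|F w t| <= K * `|t| * `|w|.
  move=> tT; have := @mean_value_center R^o (F w) (fun s => D w (c s)) 0 0 t (`|w| * K)
     mean_value_space_real.
  rewrite addr0 F0 scaler0 !subr0 [K * _ * _]mulrC mulrA; apply.
  - by move=> s /(ball0 _ _ tT); exact: dF.
  - move=> s /(ball0 _ _ tT) sT; rewrite subr0 (le_trans (DCS _ _))//.
    by rewrite ler_wpM2l// cK.
have /choice[C CF] (t : R) : exists z, `|t| < T -> forall w, D z w = F w t.
  have [tT|_] := ltP `|t| T; last by exists 0.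
  have [l lF] := contlin_of_bounded (Flin t tT) (fun w => Fbound t w tT).
  by have [z zl] := riesz l; exists z => _ w; rewrite zl lF.
exists C.
  by apply/eqP; rewrite -normr_eq0 -sqrf_eq0 -Dnorm CF ?F0// normr0.
move=> t tT; apply/is_derive1_diff; apply: is_diff_intro.
- by move=> a x y; rewrite scalerDl scalerA.
- by move=> x; apply: scalel_continuous.
move=> e e0.
have /cvgrPdist_le/(_ e e0)/nbhs_ballP[d /= d0 dP] := cc t.
have dT0 : 0 < Num.min d (T - `|t|) by rewrite lt_min d0 subr_gt0.
apply: filterS (nbhsx_ballx 0 _ dT0) => h.
rewrite -ball_normE/= sub0r normrN lt_min => /andP[hd hT].
have inT (s : R) : `|s - t| <= `|h| -> `|s| < T.
  move=> sh; rewrite -[s](subrK t) (le_lt_trans (ler_normD _ _))//; lra.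
(* Pairing the remainder [w] with itself turns its squared norm into the remainder of the real
   function [F w]. *)
set w := C (h + t) - C t - h *: c t.
have wE (z : H) : D z w = D z (C (h + t)) - D z (C t) - h *: D z (c t).
  by rewrite /w linearB linearB linearZ.
have [->|w0] := eqVneq w 0; first by rewrite normr0 mulr_ge0// ltW.
have := @mean_value_center R^o (F w) (fun s => D w (c s)) (D w (c t)) t h (`|w| * e)
     mean_value_space_real.
rewrite -!CF ?inT ?addrK ?subrr ?normr0// (Dsym _ w) (Dsym (C t) w).
rewrite -wE Dnorm normrX normr_id expr2 -mulrA.
rewrite ler_pM2l ?normr_gt0//; apply => s sh.
  by apply: dF; exact: inT.
rewrite -linearB (le_trans (DCS _ _))// ler_wpM2l// distrC; apply: dP.
by rewrite -ball_normE/= distrC (le_lt_trans sh).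
Qed.

End HilbertCurves.

Lemma exprS_half_lt (e : R) : 0 < e -> \forall n \near \oo, (2^-1 : R) ^+ n < e.
Proof.
move=> /invS_lt; apply: filterS => n; apply: le_lt_trans.
rewrite exprVn lef_pV2 ?posrE ?exprn_gt0//.
by rewrite -natrX ler_nat; exact: ltn_expl.
Qed.

(** * Picard iteration for second-order equations *)

Definition bounded_curve W (V : R) (w : R -> W) :=
  continuous w /\ forall t, `|w t| <= V.

(** The contraction principle in the uniform norm: consecutive iterates are within [2 V 2^-n] of
    each other, and bounded continuous curves are stable under uniform limits. *)
Lemma curve_fixpoint (E : completeNormedModType R) (V : R)
    (Phi : (R -> E) -> (R -> E)) (w0 : R -> E) :
  bounded_curve V w0 ->
  (forall w, bounded_curve V w -> bounded_curve V (Phi w)) ->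
  (forall w w' M, bounded_curve V w -> bounded_curve V w' ->
    (forall t, `|w t - w' t| <= M) ->
    forall t, `|Phi w t - Phi w' t| <= M / 2) ->
  exists2 w, bounded_curve V w & forall t, Phi w t = w t.
Proof.
move=> Pw0 PPhi Phi2.
have V0 : 0 <= V by apply: le_trans (Pw0.2 0).
pose w n := iter n Phi w0.
have Pw n : bounded_curve V (w n) by elim: n => //= n; exact: PPhi.
pose q n : R := 2^-1 ^+ n.
have qS n : q n.+1 = q n / 2 by rewrite /q exprSr.
have q_ge0 n : 0 <= q n by rewrite exprn_ge0// invr_ge0.
have q_le1 n : q n <= 1.
  by rewrite /q exprn_ile1// ?invr_ge0// invf_le1// ler1n.
have wS n t : `|w n.+1 t - w n t| <= 2 * V * q n.
  elim: n t => [t|n ih t].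
    rewrite /q expr0 mulr1 (le_trans (ler_normB _ _))//.
    by have := (Pw 1).2 t; have := Pw0.2 t; rewrite /=; lra.
  rewrite qS mulrA; exact: (Phi2 _ _ _ (Pw n.+1) (Pw n) ih).
(* The factor [1 - q k] is the exact partial sum of the geometric series, which makes the induction
   go through. *)
have wnk n k t : `|w (k + n)%N t - w n t| <= 4 * V * q n * (1 - q k).
  elim: k => [|k ih]; first by rewrite add0n subrr normr0 /q expr0 subrr mulr0.
  rewrite -(subrKA (w (k + n)%N t)) (le_trans (ler_normD _ _))//.
  rewrite (le_trans (lerD (wS _ _) ih))// qS.
  have -> : q (k + n)%N = q k * q n by rewrite /q exprD.
  by rewrite le_eqVlt; apply/orP; left; apply/eqP; field.
have wn_le n k t : `|w (k + n)%N t - w n t| <= 4 * V * q n.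
  rewrite (le_trans (wnk _ _ _))// ler_piMr ?mulr_ge0//.
  by have := q_ge0 k; lra.
have qV e : 0 < e -> \forall n \near \oo, 4 * V * q n < e.
  move=> e0; have d0 : 0 < e / (4 * V + 1).
    by rewrite divr_gt0// ltr_wpDl// mulr_ge0.
  apply: filterS (exprS_half_lt d0) => n; rewrite -/(q n) ltr_pdivlMr.
    by have := q_ge0 n; lra.
  by rewrite ltr_wpDl// mulr_ge0.
have /choice[u uP] t : exists l : E, (fun n => w n t) @ \oo --> l.
  apply: cauchy_cvg_dist => e /qV [N _ /(_ N (leqnn N)) /= Ne].
  exists N => n Nn; rewrite distrC (le_lt_trans _ Ne)//.
  by rewrite -(subnK Nn); exact: wn_le.
have wu n t : `|w n t - u t| <= 4 * V * q n.
  apply/ler_addgt0Pr => e e0.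
  have /cvgrPdist_lt/(_ _ e0)[N _ Ne] := uP t.
  have := Ne (N + n)%N (leq_addr n N); have := wn_le n N t => h1 /= h2.
  rewrite -(subrKA (w (N + n)%N t)) (le_trans (ler_normD _ _))// lerD//.
    by rewrite distrC.
  by rewrite distrC ltW.
have Pu : bounded_curve V u.
  split=> [t|t]; last first.
    apply/ler_addgt0Pr => e /qV [N _ /(_ N (leqnn N)) /= Ne].
    rewrite -[u t](subKr (w N t)) (le_trans (ler_normB _ _))// lerD//.
      exact: (Pw N).2.
    by rewrite (le_trans (wu _ _))// ltW.
  apply/cvgrPdist_le => e e0.
  have e30 : 0 < e / 3 by rewrite divr_gt0.
  have [N _ /(_ N (leqnn N)) /= Ne] := qV _ e30.
  have /cvgrPdist_le/(_ _ e30) := (Pw N).1 t; apply: filterS => s ts.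
  rewrite -(subrKA (w N t)) (le_trans (ler_normD _ _))//.
  rewrite -[w N t - u s](subrKA (w N s)).
  have := ler_normD (w N t - w N s) (w N s - u s).
  have := wu N s; have := wu N t; rewrite (distrC (w N t)); lra.
exists u => // t; apply/eqP; rewrite -subr_eq0 -normr_le0.
apply/ler_addgt0Pr => e e0; rewrite add0r.
have e20 : 0 < e / 2 by rewrite divr_gt0.
have [N _ /(_ N (leqnn N)) /= Ne] := qV _ e20.
have := Phi2 _ _ _ (Pw N) Pu (wu N) t; have := wu N.+1 t.
rewrite -(subrKA (w N.+1 t)) qS /=.
have := ler_normD (Phi u t - Phi (w N) t) (Phi (w N) t - u t).
rewrite (distrC (Phi u t)).
have : 0 <= V * q N by rewrite mulr_ge0.
lra.
Qed.

(** The unknown of the fixed point is the velocity [w] alone: the position is [X w], the initial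
    point plus an antiderivative of [w], and [Phi w] is the initial velocity plus an antiderivative
    of [F (X w) w]. The time [tau] is fixed before the initial data. *)
Lemma second_order_ivp (H : completeNormedModType R) (hilbertH : hilbert_space H)
    (F : H -> H -> H) (x0 : H) (r V N L : R) :
  0 < r -> 0 < V -> 0 <= L ->
  (forall x v, ball x0 r x -> `|v| <= V -> `|F x v| <= N) ->
  (forall x y u v, ball x0 r x -> ball x0 r y -> `|u| <= V -> `|v| <= V ->
    `|F x u - F y v| <= L * (`|x - y| + `|u - v|)) ->
  exists2 tau : R, 0 < tau & forall x v, ball x0 (r / 2) x -> `|v| <= V / 2 ->
    exists c c1 : R -> H, [/\ c 0 = x, c1 0 = v & forall t : R, `|t| < tau ->
      [/\ ball x0 r (c t), `|c1 t| <= V, is_derive t 1 c (c1 t) &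
          is_derive t 1 c1 (F (c t) (c1 t))]].
Proof.
move=> r0 V0 L0 FN FL.
have [D [Dsym Dnorm DCS]] := hilbert_form hilbertH.
have mvH := mean_value_space_hilbert Dnorm DCS.
have N0 : 0 <= N.
  by rewrite (le_trans _ (FN x0 0 _ _))// ?normr0 ?ltW//; exact: ballxx.
(* The bounds on [tau] keep the position in the ball ([V tau <= r / 2]), keep the velocity below [V]
   ([N tau <= V / 2]), and make [Phi] contract by one half. *)
pose tau := Num.min 1 (Num.min (r / (2 * V))
  (Num.min (V / (2 * (N + 1))) (1 / (4 * (L + 1))))).
have N1 : 0 < N + 1 by rewrite ltr_wpDl.
have L1 : 0 < L + 1 by rewrite ltr_wpDl.
have tau0 : 0 < tau by rewrite !lt_min ltr01 !divr_gt0 ?invr_gt0 ?mulr_gt0.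
have [tau1 tauV tauN tauL] : [/\ tau <= 1, V * tau <= r / 2, N * tau <= V / 2 &
    L * (tau + 1) * tau <= 2^-1].
  have : tau <= tau by [].
  rewrite {2}/tau !le_min => /and4P[t1 t2 t3 t4].
  move: t2 t3 t4; rewrite !ler_pdivlMr ?mulr_gt0// => t2 t3 t4.
  split=> //; [by lra|by nra|].
  have : L * tau * tau <= L * tau by rewrite ler_piMr// mulr_ge0// ltW.
  nra.
(* Time is clamped to [[- tau, tau]] so that the Picard operator acts on total
   functions. *)
pose cl (t : R) := Num.max (- tau) (Num.min t tau).
have cl_le t : `|cl t| <= tau.
  rewrite ler_norml /cl le_max lexx/= ge_max ge_min lexx orbT andbT.
  by rewrite (le_trans _ (ltW tau0))// oppr_le0 ltW.
have cl_id t : `|t| < tau -> cl t = t.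
  rewrite ltr_norml /cl => /andP[t1 t2].
  by rewrite (min_idPl _) ?(max_idPr _)// ltW.
have cl_cont : continuous cl.
  move=> t; apply: (@continuous_max _ _ (fun=> - tau) (fun s => Num.min s tau)).
    exact: cst_continuous.
  by apply: (@continuous_min _ _ id (fun=> tau)); [exact: id|exact: cst_continuous].
have cl0 : cl 0 = 0 by rewrite cl_id ?normr0.
(* The antiderivatives live on a larger interval, so that they are differentiable at the clamped
   times [tau] and [- tau] too. *)
have T0 : 0 < tau + 1 by rewrite addr_gt0.
have /choice[A AP] (c : R -> H) : exists C : R -> H, continuous c ->
    C 0 = 0 /\ forall t : R, `|t| < tau + 1 -> is_derive t 1 C (c t).
  have [cc|] := pselect (continuous c); last by exists (cst 0).
  by have [C C0 dC] := hilbert_antiderivative Dsym Dnorm DCS T0 cc; exists C.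
have clT t : `|cl t| < tau + 1 by rewrite (le_lt_trans (cl_le t))// ltrDl.
have A0 c : continuous c -> A c 0 = 0 by case/AP.
have dA c (t : R) : continuous c -> `|t| < tau + 1 -> is_derive t 1 (A c) (c t).
  by case/AP => _; apply.
have Acl_cont c : continuous c -> continuous (A c \o cl).
  move=> cc t; apply: continuous_comp; first exact: cl_cont.
  exact: is_derive1_continuous (dA _ _ cc (clT t)).
have A_diff c d M t : continuous c -> continuous d ->
    (forall s, `|c s - d s| <= M) -> `|A c (cl t) - A d (cl t)| <= M * tau.
  move=> cc cd cdM.
  have M0 : 0 <= M by rewrite (le_trans _ (cdM 0)).
  have := @mean_value_center H (fun s => A c s - A d s) (fun s => c s - d s) 0 0
    (cl t) M mvH.
  rewrite addr0 !A0// subrr scaler0 !subr0 => h.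
  apply: le_trans (h _ _) _; last by rewrite ler_wpM2l.
    move=> s; rewrite subr0 => sh; have sT := le_lt_trans sh (clT t).
    by apply: is_deriveB; exact: dA.
  by move=> s _; rewrite subr0.
have A_le c M t : continuous c -> (forall s, `|c s| <= M) -> `|A c (cl t)| <= M * tau.
  move=> cc cM; have M0 : 0 <= M by rewrite (le_trans _ (cM 0)).
  have := @mean_value_center H (A c) c 0 0 (cl t) M mvH.
  rewrite addr0 !A0// scaler0 !subr0 => h.
  apply: le_trans (h _ _) _; last by rewrite ler_wpM2l.
    by move=> s; rewrite subr0 => sh; apply: dA => //; exact: le_lt_trans sh (clT t).
  by move=> s _; rewrite subr0.
exists tau => // x v x0x vV.
pose X w t := x + A w (cl t).
have X_cont w : continuous w -> continuous (X w).
  by move=> cw t; apply: cvgD; [exact: cvg_cst|exact: Acl_cont].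
have X_ball w t : bounded_curve V w -> ball x0 r (X w t).
  move=> [cw wV]; move: x0x; rewrite -!ball_normE/= /X opprD addrA => x0x.
  rewrite (le_lt_trans (ler_normB _ _))//.
  by have := A_le _ _ t cw wV; lra.
have FX_cont w : bounded_curve V w -> continuous (fun s => F (X w s) (w s)).
  move=> Pw t; apply/cvgrPdist_le => e e0.
  have d0 : 0 < e / (2 * (L + 1)) by rewrite divr_gt0// mulr_gt0.
  have /cvgrPdist_le/(_ _ d0) hX := X_cont _ Pw.1 t.
  have /cvgrPdist_le/(_ _ d0) hw := Pw.1 t.
  apply: filterS2 hX hw => s.
  rewrite !ler_pdivlMr ?mulr_gt0// => h1 h2.
  rewrite (le_trans (FL _ _ _ _ (X_ball _ _ Pw) (X_ball _ _ Pw) (Pw.2 _) (Pw.2 _)))//.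
  have : 0 <= `|X w t - X w s| by []. have : 0 <= `|w t - w s| by [].
  nra.
pose Phi w t := v + A (fun s => F (X w s) (w s)) (cl t).
have [||w w' M Pw Pw' ww' t|w Pw wE] := @curve_fixpoint H V Phi (cst 0).
- by split=> [|t]; [exact: cst_continuous|rewrite normr0 ltW].
- move=> w Pw; have cF := FX_cont _ Pw; split=> [t|t].
    by apply: cvgD; [exact: cvg_cst|exact: Acl_cont].
  rewrite (le_trans (ler_normD _ _))//.
  have := A_le _ N t cF (fun s => FN _ _ (X_ball _ s Pw) (Pw.2 s)); lra.
- have M0 : 0 <= M by rewrite (le_trans _ (ww' 0)).
  rewrite /Phi opprD addrACA subrr add0r.
  have := A_diff _ _ (L * (tau + 1) * M) t (FX_cont _ Pw) (FX_cont _ Pw').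
  move=> h; apply: le_trans (h _) _; last first.
    by rewrite mulrAC mulrC ler_wpM2l.
  move=> s.
  rewrite (le_trans (FL _ _ _ _ (X_ball _ _ Pw) (X_ball _ _ Pw') (Pw.2 _) (Pw'.2 _)))//.
  rewrite -mulrA ler_wpM2l// mulrDl mul1r lerD//.
  by rewrite /X opprD addrACA subrr add0r mulrC; exact: A_diff Pw.1 Pw'.1 ww'.
exists (X w), w; split.
- by rewrite /X cl0 A0 ?addr0//; exact: Pw.1.
- by rewrite -wE /Phi cl0 A0 ?addr0//; exact: FX_cont.
move=> t tt; have tT : `|t| < tau + 1 by rewrite (lt_trans tt)// ltrDl.
have cl_near : \forall s \near t, cl s = s.
  have tt0 : 0 < tau - `|t| by rewrite subr_gt0.
  apply: filterS (nbhsx_ballx t _ tt0) => s; rewrite -ball_normE/= => ts.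
  apply: cl_id; rewrite -[s](subKr t) (le_lt_trans (ler_normB _ _))//.
  by rewrite -ltrBrDl.
split; [exact: X_ball|exact: Pw.2| |].
- have dwt := dA w t Pw.1 tT.
  have := is_deriveD (is_derive_cst x t 1) dwt; rewrite add0r.
  apply: near_eq_is_derive; apply: filterS cl_near => s cls.
  by rewrite /X cls.
- have dFt := dA _ t (FX_cont _ Pw) tT.
  have := is_deriveD (is_derive_cst v t 1) dFt; rewrite add0r.
  apply: near_eq_is_derive; apply: filterS cl_near => s cls.
  by rewrite -wE /Phi cls.
Qed.

End Calculus.

(** * Geodesics in a chart *)

Section ChartGeodesics.
Context {R : realType}.
Implicit Types V W : normedModType R.

Lemma ler_contlin2 V1 V2 W (f : 'L(V1, 'L(V2, W))) x y :
  `|f x y| <= `|f| * `|x| * `|y|.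
Proof.
by rewrite (le_trans (ler_contlin _ _))// ler_wpM2r// ler_contlin.
Qed.

Lemma ler_contlin3 V1 V2 V3 W (f : 'L(V1, 'L(V2, 'L(V3, W)))) x y z :
  `|f x y z| <= `|f| * `|x| * `|y| * `|z|.
Proof.
by rewrite (le_trans (ler_contlin2 _ _ _))// !ler_wpM2r// ler_contlin.
Qed.

(** Continuity at [x0] bounds [G], [G'] and [G''] on a ball, and the mean value inequality turns the
    bounds on [G'] and [G''] into Lipschitz constants for [G] and [G']. The second derivative is
    what makes the geodesic equation Lipschitz; half of the coercivity survives near [x0]. *)
Lemma metric_local_bounds (H : completeNormedModType R) (U : set H)
    (G : H -> 'L(H, 'L(H, R^o))) (x0 : H) (c0 : R) :
  open U -> U x0 -> Ck 2 U G -> 0 < c0 ->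
  (forall v, c0 * `|v| ^+ 2 <= G x0 v v) ->
  exists r c K (G' : H -> 'L(H, 'L(H, 'L(H, R^o)))), [/\ 0 < r, 0 < c, 0 < K,
    forall x, ball x0 r x -> [/\ U x, is_diff x G (G' x), `|G x| <= K, `|G' x| <= K &
      forall v, c * `|v| ^+ 2 <= G x v v] &
    forall x y, ball x0 r x -> ball x0 r y ->
      `|G x - G y| <= K * `|x - y| /\ `|G' x - G' y| <= K * `|x - y|].
Proof.
move=> oU Ux0 [G' [dG [G'' [dG' cG'']]]] c00 Gc0.
have aux (a b d : R) : c0 * d <= a -> a - b <= c0 / 2 * d -> c0 / 2 * d <= b.
  by clear; lra.
have c20 : 0 < c0 / 2 by rewrite divr_gt0.
have cG : {for x0, continuous G}.
  by have [/differentiable_continuous] := dG _ Ux0.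
have cG' : {for x0, continuous G'}.
  by have [/differentiable_continuous] := dG' _ Ux0.
have /cvgrPdist_lt/(_ _ c20) nG := cG.
have /cvgrPdist_lt/(_ _ ltr01) nG' := cG'.
have /cvgrPdist_lt/(_ _ ltr01) nG'' := cG'' _ Ux0.
have nU : \forall x \near x0, U x by exact: open_nbhs_nbhs.
have [r /= r0 rP] := (nbhs_ballP _ _).1 (filterI nU (filterI nG (filterI nG' nG''))).
have bnd (W : normedModType R) (a b : W) e : `|a - b| < e -> `|b| <= `|a| + e.
  by move=> ab; rewrite -[b](subKr a) (le_trans (ler_normB _ _))// lerD2l ltW.
pose K := `|G x0| + c0 / 2 + (`|G' x0| + 1) + (`|G'' x0| + 1).
have a0 := normr_ge0 (G x0). have a1 := normr_ge0 (G' x0).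
have a2 := normr_ge0 (G'' x0).
have K0 : 0 < K.
  rewrite /K; move: a0 a1 a2; move: (`|G x0|) (`|G' x0|) (`|G'' x0|) => *; lra.
have Kx x : ball x0 r x -> [/\ `|G x| <= K, `|G' x| <= K & `|G'' x| <= K].
  move=> /rP[_ [/bnd h1 [/bnd h2 /bnd h3]]]; rewrite /K.
  move: h1 h2 h3 a0 a1 a2; move: (`|G x|) (`|G' x|) (`|G'' x|) (`|G x0|) (`|G' x0|).
  by move: (`|G'' x0|) => *; split; lra.
have mvR := mean_value_space_real.
exists r, (c0 / 2), K, G'; split => //.
  move=> x xr; have [k1 k2 _] := Kx x xr; have [Ux [gx _]] := rP x xr.
  split => // [|v]; first exact: dG.
  have : G x0 v v - G x v v <= c0 / 2 * `|v| ^+ 2.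
    rewrite -!contlinBE (le_trans (ler_norm _))// (le_trans (ler_contlin2 _ _ _))//.
    by rewrite expr2 mulrA !ler_wpM2r// ltW.
  exact: aux (Gc0 v).
move=> x y xr yr; split.
- apply: (@mean_value_ball _ _ _ G G' x0 r K _ _ _ x y xr yr).
  + by do 2!apply: mean_value_space_contlin.
  + by move=> z zr; apply: dG; have [] := rP z zr.
  + by move=> z zr; have [_ k _] := Kx z zr.
- apply: (@mean_value_ball _ _ _ G' G'' x0 r K _ _ _ x y xr yr).
  + by do 3!apply: mean_value_space_contlin.
  + by move=> z zr; apply: dG'; have [] := rP z zr.
  + by move=> z zr; have [_ _ k] := Kx z zr.
Qed.

Lemma contlinrD V W (f : 'L(V, W)) x y : f (x + y) = f x + f y.
Proof. exact: linearD. Qed.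

Lemma contlinrB V W (f : 'L(V, W)) x y : f (x - y) = f x - f y.
Proof. exact: linearB. Qed.

Lemma contlinrN V W (f : 'L(V, W)) x : f (- x) = - f x.
Proof. exact: linearN. Qed.

Lemma contlinrZ V W (f : 'L(V, W)) a x : f (a *: x) = a *: f x.
Proof. exact: linearZ. Qed.

Lemma ler_half_add (a b k : R) : 0 <= b -> a <= k -> b <= k ->
  2^-1 * a + b <= 2 * k.
Proof. lra. Qed.

(* [z = - Gamma(v, v)], by the Koszul formula. *)
Lemma geodesic_spray_exists (H : completeNormedModType R)
    (B : 'L(H, 'L(H, R^o))) (T : 'L(H, 'L(H, 'L(H, R^o)))) (c : R) (v : H) :
  0 < c -> (forall u w, B u w = B w u) ->
  (forall w, c * `|w| ^+ 2 <= B w w) ->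
  exists z, forall w, B z w = 2^-1 * T w v v - T v v w :> R.
Proof.
move=> c0 Bsym Bco; pose l w : R := 2^-1 * T w v v - T v v w.
have llin : linear (l : H -> R^o).
  move=> a u w; rewrite /l.
  have -> : T (a *: u + w) v v = a * T u v v + T w v v :> R.
    by rewrite linearP contlinDE contlinZE; reflexivity.
  have -> : T v v (a *: u + w) = a * T v v u + T v v w :> R.
    by rewrite linearP; reflexivity.
  rewrite -[a *: _]/(a * _ : R).
  move: (T u v v : R) (T w v v : R) (T v v u : R) (T v v w : R) => *; ring.
have [|L LE] := @contlin_of_bounded R H R^o l (2 * (`|T| * `|v| ^+ 2)) llin.
  move=> w; rewrite /l; apply: le_trans (ler_normB _ _) _.
  rewrite normrM (@ger0_norm _ 2^-1) ?invr_ge0// -mulrA.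
  have h1 : `|T w v v : R| <= `|T| * `|w| * `|v| * `|v| := ler_contlin3 T w v v.
  have h2 : `|T v v w : R| <= `|T| * `|v| * `|v| * `|w| := ler_contlin3 T v v w.
  apply: ler_half_add; first exact: normr_ge0.
    by rewrite (le_trans h1)// expr2 -!mulrA [`|w| * _]mulrC -!mulrA.
  by rewrite (le_trans h2)// expr2 -!mulrA.
have [z zE] := coercive_riesz c0 Bsym Bco L.
by exists z => w; rewrite zE LE.
Qed.

(** * Bounds and Lipschitz estimates for the geodesic equation *)

Section SprayEstimates.
Context {H : completeNormedModType R} (S : set H) (g : H -> H -> H -> R)
  (g' : H -> H -> H -> H -> R) (c K : R).
Hypotheses (c0 : 0 < c) (K0 : 0 < K)
  (gB : forall x u v w, g x (u - v) w = g x u w - g x v w)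
  (g'Bl : forall x u v w1 w2, g' x (u - v) w1 w2 = g' x u w1 w2 - g' x v w1 w2)
  (g'Bm : forall x w u v w2, g' x w (u - v) w2 = g' x w u w2 - g' x w v w2)
  (g'Br : forall x w1 w2 u v, g' x w1 w2 (u - v) = g' x w1 w2 u - g' x w1 w2 v)
  (g'_le : forall x w u v, S x -> `|g' x w u v| <= K * `|w| * `|u| * `|v|)
  (g_coercive : forall x v, S x -> c * `|v| ^+ 2 <= g x v v)
  (g_lip : forall x y u v, S x -> S y ->
    `|g x u v - g y u v| <= K * `|x - y| * `|u| * `|v|)
  (g'_lip : forall x y w u v, S x -> S y ->
    `|g' x w u v - g' y w u v| <= K * `|x - y| * `|w| * `|u| * `|v|).

(** The Koszul formula on the diagonal, with the sign for which the geodesic equation reads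
    [c'' = z]. Here [g] and [g'] stand for the real values of a metric and of its derivative. *)
Definition geodesic_spray (x v z : H) :=
  forall w, g x z w = 2^-1 * g' x w v v - g' x v v w.

(** Testing the formula with [w = z] gives [c |z|^2 <= (3/2) K |v|^2 |z|]. *)
Lemma geodesic_spray_bound x v z : S x -> geodesic_spray x v z ->
  `|z| <= 2 * K / c * `|v| ^+ 2.
Proof.
move=> xr /(_ z) zE; have [->|zN0] := eqVneq z 0.
  by rewrite normr0 mulr_ge0 ?exprn_ge0// divr_ge0// ?mulr_ge0// ltW.
have z0 : 0 < `|z| by rewrite normr_gt0.
rewrite mulrAC ler_pdivlMr// -(ler_pM2r z0).
have := g_coercive z xr; rewrite zE.
have := g'_le z v v xr; have := g'_le v v z xr.
rewrite !ler_norml => /andP[h1 h2] /andP[h3 h4] h5.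
lra.
Qed.

(** The two formulas are subtracted and tested with [d = z1 - z2]; coercivity at [x] then bounds
    [c |d|^2] by terms linear in [|d|]. *)
Lemma geodesic_spray_lipschitz (V : R) x y u v z1 z2 : 0 <= V ->
  S x -> S y -> `|u| <= V -> `|v| <= V ->
  geodesic_spray x u z1 -> geodesic_spray y v z2 ->
  `|z1 - z2| <= (2 * K * V ^+ 2 + 4 * K * V + K * (2 * K / c * V ^+ 2)) / c *
    (`|x - y| + `|u - v|).
Proof.
move=> V0 xr yr uV vV z1E z2E; set d := z1 - z2.
set A := 2 * K / c * V ^+ 2.
have A0 : 0 <= A by rewrite mulr_ge0 ?exprn_ge0// divr_ge0// ?mulr_ge0// ltW.
have z2V : `|z2| <= A.
  rewrite (le_trans (geodesic_spray_bound yr z2E))// ler_wpM2l//.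
    by rewrite divr_ge0// ?mulr_ge0// ltW.
  by rewrite ler_pXn2r// ?nnegrE.
have K_ge0 := ltW K0; have c_ge0 := ltW c0.
have [->|dN0] := eqVneq d 0.
  have h1 : 0 <= K * V ^+ 2 by rewrite mulr_ge0 ?exprn_ge0.
  have h2 : 0 <= K * V by rewrite mulr_ge0.
  have h3 : 0 <= K * A by rewrite mulr_ge0.
  rewrite normr0 mulr_ge0 ?addr_ge0// divr_ge0//; lra.
have d0 : 0 < `|d| by rewrite normr_gt0.
rewrite mulrAC ler_pdivlMr// -(ler_pM2r d0).
have -> : `|d| * c * `|d| = c * `|d| ^+ 2 by ring.
apply: le_trans (g_coercive d xr) _.
(* Three kinds of differences: the base point in [g'], the velocity in one slot of [g'] at a time,
   and the base point of the metric applied to [z2], which is at most [A]. *)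
have key : g x d d = 2^-1 * ((g' x d u u - g' y d u u) +
      (g' y d (u - v) u + g' y d v (u - v))) -
   ((g' x u u d - g' y u u d) + (g' y (u - v) u d + g' y v (u - v) d)) -
   (g x z2 d - g y z2 d).
  by rewrite {1}/d gB z1E z2E !(g'Bl, g'Bm, g'Br); lra.
set P := K * `|x - y| * V ^+ 2 * `|d|.
set Q := K * V * `|u - v| * `|d|.
have e1 : `|g' x d u u - g' y d u u| <= P.
  apply: le_trans (g'_lip _ _ _ xr yr) _.
  rewrite (_ : P = K * `|x - y| * `|d| * V * V); last by rewrite /P; ring.
  by rewrite ler_pM// ?mulr_ge0// ler_pM// ?mulr_ge0.
have e2 : `|g' x u u d - g' y u u d| <= P.
  apply: le_trans (g'_lip _ _ _ xr yr) _.
  rewrite (_ : P = K * `|x - y| * V * V * `|d|); last by rewrite /P; ring.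
  by rewrite ler_pM// ?mulr_ge0// ler_pM// ?mulr_ge0// ler_pM// mulr_ge0.
have e3 : `|g' y d (u - v) u| <= Q.
  apply: le_trans (g'_le _ _ _ yr) _.
  rewrite (_ : Q = K * `|d| * `|u - v| * V); last by rewrite /Q; ring.
  by rewrite ler_pM// ?mulr_ge0.
have e4 : `|g' y d v (u - v)| <= Q.
  apply: le_trans (g'_le _ _ _ yr) _.
  rewrite (_ : Q = K * `|d| * V * `|u - v|); last by rewrite /Q; ring.
  by rewrite ler_pM// ?mulr_ge0// ler_pM// mulr_ge0.
have e5 : `|g' y (u - v) u d| <= Q.
  apply: le_trans (g'_le _ _ _ yr) _.
  rewrite (_ : Q = K * `|u - v| * V * `|d|); last by rewrite /Q; ring.
  by rewrite ler_pM// ?mulr_ge0// ler_pM// mulr_ge0.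
have e6 : `|g' y v (u - v) d| <= Q.
  apply: le_trans (g'_le _ _ _ yr) _.
  rewrite (_ : Q = K * V * `|u - v| * `|d|); last by rewrite /Q; ring.
  by rewrite ler_pM// ?mulr_ge0// ler_pM// ?mulr_ge0// ler_pM.
have e7 : `|g x z2 d - g y z2 d| <= K * A * `|x - y| * `|d|.
  apply: le_trans (g_lip _ _ xr yr) _.
  rewrite (_ : K * A * _ * _ = K * `|x - y| * A * `|d|); last by ring.
  by rewrite ler_pM// ?mulr_ge0// ler_pM// mulr_ge0.
have P0 : 0 <= P by rewrite !mulr_ge0 ?exprn_ge0.
have Q0 : 0 <= Q by rewrite !mulr_ge0.
have : g x d d <= 2 * P + 4 * Q + K * A * `|x - y| * `|d|.
  rewrite key; move: e1 e2 e3 e4 e5 e6 e7; rewrite !ler_norml.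
  move=> /andP[? ?] /andP[? ?] /andP[? ?] /andP[? ?] /andP[? ?] /andP[? ?] /andP[? ?].
  lra.
move/le_trans; apply.
have : 0 <= 2 * K * V ^+ 2 * `|u - v| * `|d| by rewrite !mulr_ge0 ?exprn_ge0.
have : 0 <= 4 * K * V * `|x - y| * `|d| by rewrite !mulr_ge0.
have KA0 : 0 <= K * A by rewrite mulr_ge0.
have : 0 <= K * A * `|u - v| * `|d| by rewrite mulr_ge0// mulr_ge0.
rewrite /P /Q; lra.
Qed.

End SprayEstimates.

Lemma ler_contlin2_dist V1 V2 W (f h : 'L(V1, 'L(V2, W))) x y :
  `|f x y - h x y| <= `|f - h| * `|x| * `|y|.
Proof.
have -> : f x y - h x y = (f - h) x y by rewrite !contlinBE; reflexivity.
exact: ler_contlin2.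
Qed.

Lemma ler_contlin3_dist V1 V2 V3 W (f h : 'L(V1, 'L(V2, 'L(V3, W)))) x y z :
  `|f x y z - h x y z| <= `|f - h| * `|x| * `|y| * `|z|.
Proof.
have -> : f x y z - h x y z = (f - h) x y z by rewrite !contlinBE; reflexivity.
exact: ler_contlin3.
Qed.

Section GeodesicEquation.
Context {H : completeNormedModType R} (G : H -> 'L(H, 'L(H, R^o)))
  (T : 'L(H, 'L(H, 'L(H, R^o)))).

Lemma christoffel_spray (x v z : H) : is_diff x G T ->
  (forall w, G x z w = 2^-1 * T w v v - T v v w :> R) ->
  christoffel G x v v (- z).
Proof.
move=> [_ dGE] zE w; rewrite dGE.
have -> : G x (- z) w = - G x z w :> R by rewrite contlinrN; reflexivity.
rewrite zE; move: (T w v v : R) (T v v w : R) => a b.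
by field.
Qed.

(** Conservation of speed: tested with [w = s1 t], the geodesic equation gives
    [2 G(s2, s1) = - T(s1, s1, s1)], which cancels the derivative of the metric along the curve. *)
Lemma is_derive1_energy (s s1 : R -> H) (t : R) (s2 : H) :
  is_diff (s t) G T -> (forall u v, G (s t) u v = G (s t) v u) ->
  is_derive t 1 s (s1 t) -> is_derive t 1 s1 s2 ->
  (forall w, G (s t) s2 w = 2^-1 * T w (s1 t) (s1 t) - T (s1 t) (s1 t) w :> R) ->
  is_derive t 1 (fun u => G (s u) (s1 u) (s1 u) : R) 0.
Proof.
move=> dG Gsym ds ds1 s2E.
have dA : is_derive t 1 (G \o s) (T (s1 t)) by exact: is_derive1_comp dG ds.
have dB := is_derive1_apply dA ds1.
have dC := is_derive1_apply dB ds1.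
apply: is_derive_eq dC _.
have -> : (T (s1 t) (s1 t) + (G \o s) t s2) (s1 t) =
   T (s1 t) (s1 t) (s1 t) + G (s t) s2 (s1 t) :> R by reflexivity.
rewrite /comp (Gsym (s1 t) s2) s2E; move: (T (s1 t) (s1 t) (s1 t) : R) => a.
by field.
Qed.

End GeodesicEquation.

Lemma coercive_unit_le (a c : R) : 0 < c -> 0 <= a -> c * a ^+ 2 <= 1 ->
  a <= 1 + c^-1.
Proof.
move=> c0 a0 ca; have ci0 : 0 < c^-1 by rewrite invr_gt0.
have [|a1] := leP a 1; first by move: ci0; lra.
have : a ^+ 2 <= c^-1 by rewrite -[c^-1]mulr1 ler_pdivlMl.
rewrite expr2; nra.
Qed.

Lemma chart_geodesics (H : completeNormedModType R) (hilbertH : hilbert_space H)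
    (U : set H) (G : H -> 'L(H, 'L(H, R^o))) (x0 : H) (c0 : R) :
  open U -> U x0 -> Ck 2 U G ->
  (forall x, U x -> forall u v, G x u v = G x v u) ->
  0 < c0 -> (forall v, c0 * `|v| ^+ 2 <= G x0 v v) ->
  exists r c K tau N : R, [/\ 0 < r, 0 < c, 0 < K, 0 < tau & 0 <= N] /\
  [/\ ball x0 r `<=` U,
    forall x v, ball x0 r x -> c * `|v| ^+ 2 <= G x v v <= K * `|v| ^+ 2 &
    forall x v, ball x0 (r / 2) x -> G x v v = 1 :> R ->
      exists s s1 s2 : R -> H, forall t : R, `|t| < tau ->
      [/\ ball x0 r (s t), `|s t - x - t *: v| <= N * t ^+ 2,
          is_derive t 1 s (s1 t), is_derive t 1 s1 (s2 t) &
          christoffel G (s t) (s1 t) (s1 t) (- s2 t) /\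
          G (s t) (s1 t) (s1 t) = 1 :> R]].
Proof.
move=> oU Ux0 C2G Gsym c00 Gc0.
have Lge0 (k w n c : R) : 0 <= k -> 0 <= w -> 0 <= n -> 0 <= c ->
    0 <= (2 * k * w ^+ 2 + 4 * k * w + k * n) / c.
  by move=> *; rewrite divr_ge0// !addr_ge0// !mulr_ge0// ?exprn_ge0.
have [r [c [K [G' [r0 c_gt0 K0 Gx GL]]]]] := metric_local_bounds oU Ux0 C2G c00 Gc0.
pose g x u v : R := G x u v.
pose g' x w u v : R := G' x w u v.
have gB x u v w : g x (u - v) w = g x u w - g x v w.
  by rewrite /g contlinrB contlinBE; reflexivity.
have g'Bl x u v w1 w2 : g' x (u - v) w1 w2 = g' x u w1 w2 - g' x v w1 w2.
  by rewrite /g' contlinrB contlinBE; reflexivity.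
have g'Bm x w u v w2 : g' x w (u - v) w2 = g' x w u w2 - g' x w v w2.
  by rewrite /g' contlinrB contlinBE; reflexivity.
have g'Br x w1 w2 u v : g' x w1 w2 (u - v) = g' x w1 w2 u - g' x w1 w2 v.
  by rewrite /g' contlinrB; reflexivity.
have le3 (a b k1 k2 k3 : R) : 0 <= k1 -> 0 <= k2 -> 0 <= k3 -> a <= b ->
    a * k1 * k2 * k3 <= b * k1 * k2 * k3.
  by move=> *; rewrite !ler_wpM2r.
have le2 (a b k1 k2 : R) : 0 <= k1 -> 0 <= k2 -> a <= b ->
    a * k1 * k2 <= b * k1 * k2.
  by move=> *; rewrite !ler_wpM2r.
have g'_le x w u v : ball x0 r x -> `|g' x w u v| <= K * `|w| * `|u| * `|v|.
  move=> /Gx[_ _ _ xK _].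
  have h : `|g' x w u v| <= `|G' x| * `|w| * `|u| * `|v| := ler_contlin3 (G' x) w u v.
  by rewrite (le_trans h)// le3.
have g_lip x y u v : ball x0 r x -> ball x0 r y ->
    `|g x u v - g y u v| <= K * `|x - y| * `|u| * `|v|.
  move=> xr yr; have [xyK _] := GL x y xr yr.
  have h : `|g x u v - g y u v| <= `|G x - G y| * `|u| * `|v| :=
    ler_contlin2_dist (G x) (G y) u v.
  by rewrite (le_trans h)// le2.
have g'_lip x y w u v : ball x0 r x -> ball x0 r y ->
    `|g' x w u v - g' y w u v| <= K * `|x - y| * `|w| * `|u| * `|v|.
  move=> xr yr; have [_ xyK] := GL x y xr yr.
  have h : `|g' x w u v - g' y w u v| <= `|G' x - G' y| * `|w| * `|u| * `|v| :=
    ler_contlin3_dist (G' x) (G' y) w u v.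
  by rewrite (le_trans h)// le3.
have g_coercive x v : ball x0 r x -> c * `|v| ^+ 2 <= g x v v.
  by move=> /Gx[_ _ _ _]; apply.
have g_le x v : ball x0 r x -> g x v v <= K * `|v| ^+ 2.
  move=> /Gx[_ _ xK _ _].
  have h : `|g x v v| <= `|G x| * `|v| * `|v| := ler_contlin2 (G x) v v.
  rewrite (le_trans (ler_norm _))// (le_trans h)// expr2 mulrA.
  exact: le2.
pose S := ball x0 r.
have /choice[F0 F0P] (p : H * H) : exists z, S p.1 -> geodesic_spray g g' p.1 p.2 z.
  have [Sp|] := pselect (S p.1); last by exists 0.
  have [Up _ _ _ _] := Gx _ Sp.
  have [z zE] := geodesic_spray_exists (G' p.1) p.2 c_gt0 (Gsym _ Up)
    (fun v => g_coercive _ v Sp).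
  by exists z.
pose F x v := F0 (x, v).
have FP x v : S x -> geodesic_spray g g' x v (F x v) := F0P (x, v).
(* Unit vectors of the metric have norm at most [1 + c^-1]; twice this is the velocity bound, as the
   initial value problem asks for data below half of it. *)
have V0 : 0 < 2 * (1 + c^-1) by rewrite mulr_gt0// addr_gt0// invr_gt0.
set V := 2 * (1 + c^-1) in V0.
have cK0 : 0 <= 2 * K / c by rewrite divr_ge0// ?mulr_ge0// ltW.
pose N := 2 * K / c * V ^+ 2.
pose L := (2 * K * V ^+ 2 + 4 * K * V + K * N) / c.
have N0 : 0 <= N by rewrite mulr_ge0// exprn_ge0// ltW.
have L0 : 0 <= L by apply: Lge0 => //; exact: ltW.
have FN x v : ball x0 r x -> `|v| <= V -> `|F x v| <= N.
  move=> xr vV.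
  rewrite (le_trans (geodesic_spray_bound c_gt0 K0 g'_le g_coercive xr (FP x v xr)))//.
  by rewrite /N ler_wpM2l// ler_pXn2r// ?nnegrE// ltW.
have FL x y u v : ball x0 r x -> ball x0 r y -> `|u| <= V -> `|v| <= V ->
    `|F x u - F y v| <= L * (`|x - y| + `|u - v|).
  move=> xr yr uV vV.
  exact: (geodesic_spray_lipschitz c_gt0 K0 gB g'Bl g'Bm g'Br g'_le g_coercive
    g_lip g'_lip (ltW V0) xr yr uV vV (FP x u xr) (FP y v yr)).
have [tau tau0 ivp] := second_order_ivp hilbertH r0 V0 L0 FN FL.
exists r, c, K, tau, N; split => //; split.
- by move=> x /Gx[].
- by move=> x v xr; rewrite (g_coercive x v xr) (g_le x v xr).
move=> x v xr gv1.
have half_r : r / 2 <= r by rewrite ler_pdivrMr// ler_pMr// ler1n.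
have xr' : ball x0 r x by exact: le_ball xr.
have vV : `|v| <= V / 2.
  have -> : V / 2 = 1 + c^-1 by rewrite /V mulrC mulKf.
  by apply: coercive_unit_le => //; rewrite (le_trans (g_coercive x v xr'))// /g gv1.
have [s [s1 [s0 s10 sP]]] := ivp x v xr vV.
exists s, s1, (fun t => F (s t) (s1 t)) => t tt.
have [D [Dsym Dnorm DCS]] := hilbert_form hilbertH.
have mvH := mean_value_space_hilbert Dnorm DCS.
have near0 (h u : R) : `|h| < tau -> `|u - 0| <= `|h| -> `|u| < tau.
  by rewrite subr0 => ht /le_lt_trans; apply.
have [st s1V ds ds1] := sP t tt.
split => //.
(* The mean value inequality is applied twice: an acceleration of at most [N] keeps the velocity
   within [N |t|] of [v], hence the curve within [N t^2] of the line. *)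
- have := @mean_value_center _ H s s1 v 0 t (N * `|t|) mvH.
  have -> : N * `|t| * `|t| = N * t ^+ 2.
    by rewrite -mulrA -normrM -expr2 ger0_norm ?sqr_ge0.
  rewrite addr0 s0; apply.
    by move=> u /(near0 _ _ tt)/sP[].
  move=> u ut; have := @mean_value_center _ H s1 (fun t => F (s t) (s1 t)) 0 0 u N mvH.
  rewrite addr0 s10 scaler0 subr0 => h; rewrite (le_trans (h _ _))//.
  + by move=> w /(near0 _ _ (near0 _ _ tt ut))/sP[].
  + by move=> w /(near0 _ _ (near0 _ _ tt ut))/sP[sw s1w _ _]; rewrite subr0; exact: FN.
  + by rewrite ler_wpM2l// -[u]subr0.
have dG u : ball x0 r u -> is_diff u G (G' u) by case/Gx.
split; first exact: christoffel_spray (dG _ st) (FP _ _ st).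
have dE (u : R) : `|u| < tau ->
    is_derive u 1 (fun u => G (s u) (s1 u) (s1 u) : R) 0.
  move=> /sP[su _ dsu ds1u]; have [Usu _ _ _ _] := Gx _ su.
  exact: is_derive1_energy (dG _ su) (Gsym _ Usu) dsu ds1u (FP _ _ su).
have := @mean_value_center _ R^o _ (fun=> 0) 0 0 t 0 (@mean_value_space_real R).
move=> /(_ (fun u => G (s u) (s1 u) (s1 u) : R)).
rewrite addr0 s0 s10 scaler0 subr0 mul0r gv1 => h.
apply/eqP; rewrite -subr_eq0 -normr_le0.
rewrite -[X in `|X|]subr0; apply: h.
  by move=> u /(near0 _ _ tt); exact: dE.
by move=> u _; rewrite normr0.
Qed.

End ChartGeodesics.

(** * Convexity along curves *)

Section CurveConvexity.
Context {R : realType}.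
Implicit Types V W : normedModType R.

Section ConvexAlongCurves.
Context {H : normedModType R} (f : H -> R) (x0 : H) (rho tau N : R).
Hypotheses (rho0 : 0 < rho) (tau0 : 0 < tau) (N0 : 0 <= N)
  (f_cont : forall x, `|x0 - x| < rho -> {for x, continuous f})
  (f_curve : forall x e, `|x0 - x| < rho -> `|e| = 1 ->
    exists2 c : R -> H,
      forall t : R, `|t| < tau -> `|c t - x - t *: e| <= N * t ^+ 2 &
      forall s t a : R, `|s| < tau -> `|t| < tau -> 0 <= a <= 1 ->
        f (c (a * s + (1 - a) * t)) <= a * f (c s) + (1 - a) * f (c t)).

Let curve0 (c : R -> H) x e :
  (forall t : R, `|t| < tau -> `|c t - x - t *: e| <= N * t ^+ 2) -> c 0 = x.
Proof.
move=> /(_ 0); rewrite normr0 => /(_ tau0).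
rewrite scale0r subr0 expr0n/= mulr0 normr_le0 subr_eq0.
by move/eqP.
Qed.

(** As for convex functions on a vector space, bounded oscillation forces a Lipschitz bound. The
    curves are given by a starting point and a direction and need not hit a prescribed target, which
    is therefore reached only in the limit. *)
Lemma curve_convex_lipschitz : exists r L : R, [/\ 0 < r, r <= rho, 0 <= L &
  forall x y, `|x0 - x| < r -> `|x0 - y| < r -> `|f x - f y| <= L * `|x - y|].
Proof.
have x0rho : `|x0 - x0| < rho by rewrite subrr normr0.
have /cvgrPdist_lt/(_ _ ltr01) := f_cont x0rho.
move=> /nbhs_ballP[r1 /= r10 r1P].
pose r := Num.min r1 rho; have r_gt0 : 0 < r by rewrite lt_min r10.
have osc x y : `|x0 - x| < r -> `|x0 - y| < r -> f x - f y <= 2.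
  have lt_r z : `|x0 - z| < r -> `|f x0 - f z| < 1.
    by rewrite lt_min => /andP[zr _]; apply: r1P; rewrite -ball_normE.
  move=> /lt_r + /lt_r; rewrite !ltr_norml => /andP[? ?] /andP[? ?]; lra.
(* [h] is a time at which the curve exists, at which it is still in the ball where [f] oscillates by
   at most 2, and up to which it misses the line by at most half of the distance covered. *)
pose h := Num.min (tau / 2) (Num.min (r / 4) (2 * (N + 1))^-1).
have N1 : 0 < 2 * (N + 1) by rewrite mulr_gt0// ltr_wpDl.
have h0 : 0 < h by rewrite !lt_min !divr_gt0//= invr_gt0.
have [htau hr hN] : [/\ h < tau, h <= r / 4 & N * h <= 2^-1].
  have : h <= h by []. rewrite {2}/h !le_min => /and3P[h1 h2 h3].
  split => //; first by move: h1 tau0; lra.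
  move: h3; rewrite -[X in _ <= X]mul1r ler_pdivlMr//; nra.
(* The geodesic that leaves [y] in the direction of [x] passes within [|x - y| / 2]
   of [x], and convexity bounds the growth of [f] along it; iterating, the points
   converge to [x] while the increments add up to a multiple of [|x - y|]. *)
have step x y s : `|x0 - x| < h / 2 -> `|x - y| <= s -> s <= h ->
    exists2 y', `|x - y'| <= s / 2 & f y' - f y <= 2 / h * s.
  move=> xh xys sh; have s0 : 0 <= s by exact: le_trans xys.
  have [xy|xy] := eqVneq x y.
    exists x; first by rewrite subrr normr0 divr_ge0.
    by rewrite xy subrr mulr_ge0// divr_ge0// ltW.
  have d0 : 0 < `|x - y| by rewrite normr_gt0 subr_eq0.
  have x0y : `|x0 - y| < r / 2.
    rewrite -(subrKA x) (le_lt_trans (ler_normD _ _))//; move: xh xys sh hr; lra.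
  have [||c cE cconv] := @f_curve y (`|x - y|^-1 *: (x - y)).
  - rewrite (lt_le_trans x0y)// (@le_trans _ _ r)//; last by rewrite ge_min lexx orbT.
    by rewrite ler_pdivrMr// ler_pMr// ler1n.
  - by rewrite normrZ normfV normr_id mulVf// gt_eqF.
  have c0 := curve0 cE.
  exists (c `|x - y|).
    have := cE `|x - y|; rewrite normr_id scalerA mulfV ?gt_eqF// scale1r.
    rewrite opprB addrA subrK (distrC x (c _)) => h1; rewrite (le_trans (h1 _))//.
      by rewrite (le_lt_trans xys)// (le_lt_trans sh).
    have : N * `|x - y| <= 2^-1 by rewrite (le_trans _ hN)// ler_wpM2l// (le_trans xys).
    rewrite expr2 mulrA => h2; rewrite (le_trans (ler_wpM2r (ltW d0) h2))//.
    by rewrite mulrC ler_wpM2r// invr_ge0.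
  set d := `|x - y|; have dh : d <= h by exact: le_trans xys sh.
  have [d1 d2] : d / h * h + (1 - d / h) * 0 = d /\ 0 <= d / h <= 1.
    split; first by rewrite mulr0 addr0 divfK// gt_eqF.
    by rewrite (divr_ge0 (ltW d0) (ltW h0)) ler_pdivrMr// mul1r.
  have hh : `|h| < tau by rewrite gtr0_norm.
  have t00 : `|0 : R| < tau by rewrite normr0.
  have := cconv h 0 (d / h) hh t00 d2; rewrite d1 c0.
  have chy : `|c h - y| <= r / 4 + r / 8.
    have := cE h hh; set w := c h - y - _ => h1.
    have -> : c h - y = w + h *: (d^-1 *: (x - y)) by rewrite /w subrK.
    rewrite (le_trans (ler_normD _ _))// normrZ (normrZ d^-1) normfV normr_id.
    rewrite -/d mulVf ?gt_eqF// mulr1 gtr0_norm//.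
    have : N * h ^+ 2 <= 2^-1 * h by rewrite expr2 mulrA ler_wpM2r// ltW.
    by move: h1 hr; lra.
  have chr : `|x0 - c h| < r.
    rewrite -(subrKA y) (le_lt_trans (ler_normD _ _))// [X in _ + X]distrC.
    by move: x0y chy; move: r_gt0; lra.
  have yr : `|x0 - y| < r by move: x0y r_gt0; lra.
  have := osc _ _ chr yr => h1 h2.
  have h3 : d / h * (f (c h) - f y) <= d / h * 2.
    by rewrite ler_wpM2l// (andP d2).1.
  have h4 : d / h * 2 <= 2 / h * s.
    have -> : d / h * 2 = 2 / h * d by ring.
    by rewrite ler_wpM2l// divr_ge0// ltW.
  by move: h2 h3 h4; lra.
(* The increments [2 / h * s * 2^-k] sum to at most [4 / h * s]. *)
pose A := 4 / h; have A0 : 0 <= A by rewrite divr_ge0// ltW.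
have iter_step n x y s : `|x0 - x| < h / 2 -> `|x - y| <= s -> s <= h ->
    exists2 y', `|x - y'| <= s * 2^-1 ^+ n & f y' - f y <= A * s * (1 - 2^-1 ^+ n).
  move=> xh xys sh; have s0 : 0 <= s by exact: le_trans xys.
  elim: n => [|n [z xz zy]].
    by exists y; rewrite ?expr0 ?mulr1 ?subrr ?mulr0.
  have [|z' xz' zz'] := step x z _ xh xz.
    by rewrite (le_trans _ sh)// ler_piMr// exprn_ile1// ?invr_ge0// invf_le1// ler1n.
  exists z'; first by rewrite exprSr mulrA.
  rewrite exprSr; move: zy zz'; rewrite /A.
  set q := 2^-1 ^+ n; move=> h1 h2.
  have -> : f z' - f y = (f z' - f z) + (f z - f y) by ring.
  apply: le_trans (lerD h2 h1) _.
  by rewrite le_eqVlt; apply/orP; left; apply/eqP; field; rewrite gt_eqF.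
have h_rho : h / 2 <= rho.
  have : r <= rho by rewrite ge_min lexx orbT.
  by move: hr h0; lra.
have half_lip x y : `|x0 - x| < h / 2 -> `|x0 - y| < h / 2 ->
    f x - f y <= A * `|x - y|.
  move=> xh yh; apply/ler_addgt0Pr => e e0.
  have /f_cont/cvgrPdist_lt/(_ _ e0) : `|x0 - x| < rho by exact: lt_le_trans h_rho.
  move=> /nbhs_ballP[d /= d0 dP].
  have xyh : `|x - y| <= h.
    rewrite -(subrKA x0) (le_trans (ler_normD _ _))// distrC.
    by move: xh yh; lra.
  have /exprS_half_lt[n _ /(_ n (leqnn n))/= nd] : 0 < d / (h + 1).
    by rewrite divr_gt0// addr_gt0.
  have [y' xy' y'y] := iter_step n x y _ xh (lexx _) xyh.
  have : `|f x - f y'| < e.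
    apply: dP; rewrite -ball_normE/= (le_lt_trans xy')//.
    move: nd; rewrite ltr_pdivlMr ?addr_gt0//; apply: le_lt_trans.
    rewrite mulrC ler_wpM2l ?exprn_ge0 ?invr_ge0//.
    by rewrite (le_trans xyh)// lerDl.
  move=> /ltW/(le_trans (ler_norm _)) h1.
  have half0 : 0 <= 2^-1 :> R by rewrite invr_ge0.
  have := mulr_ge0 (mulr_ge0 A0 (normr_ge0 (x - y))) (exprn_ge0 n half0).
  move: y'y h1; set q := 2^-1 ^+ n; lra.
exists (h / 2), A; split => // [|x y xh yh]; first by rewrite divr_gt0.
rewrite ler_norml half_lip// andbT lerNl opprB distrC.
exact: half_lip.
Qed.

(* At the point [m] of the segment, the geodesic in the direction of the segment
   passes within [O(|x - y|^2)] of its end points. *)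
Lemma curve_semiconvex : exists r L K : R, [/\ 0 < r, 0 <= L, 0 <= K,
  forall x y, `|x0 - x| < r -> `|x0 - y| < r -> `|f x - f y| <= L * `|x - y| &
  forall x y a, `|x0 - x| < r -> `|x0 - y| < r -> 0 <= a <= 1 ->
    f (a *: x + (1 - a) *: y) <=
      a * f x + (1 - a) * f y + K * (a * (1 - a) * `|x - y| ^+ 2)].
Proof.
have [r1 [L [r10 r1rho L0 fL]]] := curve_convex_lipschitz.
have N1 : 0 < 4 * (N + 1) by rewrite mulr_gt0// ltr_wpDl.
pose r := Num.min (r1 / 2) (Num.min (tau / 2) (4 * (N + 1))^-1).
have r0 : 0 < r by rewrite !lt_min !divr_gt0//= invr_gt0.
have [rr1 rtau rN] : [/\ r <= r1 / 2, r <= tau / 2 & N * (4 * r) <= 1].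
  have : r <= r by []. rewrite {2}/r !le_min => /and3P[h1 h2 h3].
  split => //; move: h3; rewrite -[X in _ <= X]mul1r ler_pdivlMr//; nra.
have r_r1 z : `|x0 - z| < r -> `|x0 - z| < r1.
  by move=> /lt_le_trans; apply; move: rr1 r10; lra.
(* With [d = |x - y|], the end points are missed by [N ((1 - a) d)^2] and [N (a d)^2]; weighted by
   [a] and [1 - a], these add up to [N a (1 - a) d^2]. *)
exists r, L, (L * N); split => //; first by rewrite mulr_ge0.
  by move=> x y /r_r1 xr /r_r1 yr; exact: fL.
move=> x y a xr yr /andP[a0 a1].
have a1' : 0 <= 1 - a by rewrite subr_ge0.
have [->|xy] := eqVneq x y.
  rewrite -scalerDl subrr normr0 expr0n/= !mulr0 addr0 addrC subrK scale1r.
  by rewrite -mulrDl addrC subrK mul1r.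
set m := _ + _ *: y; set d := `|x - y|.
have d0 : 0 < d by rewrite normr_gt0 subr_eq0.
have d2r : d < 2 * r.
  rewrite /d -(subrKA x0) (le_lt_trans (ler_normD _ _))// distrC.
  by move: xr yr; lra.
have mE : m = y + a *: (x - y).
  by rewrite /m scalerBl scale1r scalerBr addrCA.
have x0m : `|x0 - m| < r.
  have [xb yb] : ball x0 r x /\ ball x0 r y by rewrite -ball_normE.
  have := @ball_segment _ _ x0 x y r a xb yb; rewrite -mE -ball_normE/=; apply.
  by rewrite a0.
pose e := d^-1 *: (x - y).
have e1 : `|e| = 1 by rewrite normrZ normfV normr_id mulVf// gt_eqF.
have de : d *: e = x - y by rewrite scalerA mulfV ?gt_eqF// scale1r.
have [c cE cconv] := f_curve (lt_le_trans (r_r1 _ x0m) r1rho) e1.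
have c0 := curve0 cE.
have Nd : N * d <= 2^-1 by move: rN d2r N0; nra.
have cnear t : `|t| <= d -> `|t| < tau /\ N * t ^+ 2 <= 2^-1 * `|t|.
  move=> td; split; first by rewrite (le_lt_trans td)//; move: d2r rtau; lra.
  rewrite -real_normK ?num_real// expr2 mulrA ler_wpM2r//.
  by rewrite (le_trans _ Nd)// ler_wpM2l.
have dge0 := ltW d0.
have s1d : `|(1 - a) * d| <= d by rewrite ger0_norm ?mulr_ge0// ler_piMl// gerBl.
have s2d : `|- (a * d)| <= d by rewrite normrN ger0_norm ?mulr_ge0// ler_piMl.
(* The Lipschitz bound replaces a point of the curve by the corresponding point of the line. *)
have bd z t : `|t| <= d -> m + t *: e = z -> `|x0 - z| < r ->
    f (c t) <= f z + L * (N * t ^+ 2).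
  move=> td mz zr; have [ttau Nt] := cnear t td.
  have := cE t ttau; rewrite -addrA -opprD mz => h1.
  have ctz : `|x0 - c t| < r1.
    rewrite -(subrKA z) (le_lt_trans (ler_normD _ _))// [X in _ + X]distrC.
    by move: h1 Nt td d2r rr1 zr r10; lra.
  have := fL _ _ ctz (r_r1 _ zr) => /(le_trans (ler_norm _)).
  have := ler_wpM2l L0 h1; lra.
have m1 : m + ((1 - a) * d) *: e = x.
  rewrite -scalerA de mE -addrA -scalerDl (_ : a + (1 - a) = 1); last by ring.
  by rewrite scale1r addrC subrK.
have m2 : m + (- (a * d)) *: e = y.
  by rewrite scaleNr -scalerA de mE addrK.
have t1 := bd x _ s1d m1 xr.
have t2 := bd y _ s2d m2 yr.
have a01 : 0 <= a <= 1 by rewrite a0.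
have := cconv _ _ a (cnear _ s1d).1 (cnear _ s2d).1 a01.
rewrite (_ : a * ((1 - a) * d) + (1 - a) * - (a * d) = 0); last by ring.
rewrite c0 => h; rewrite (le_trans h)//.
rewrite (le_trans (lerD (ler_wpM2l a0 t1) (ler_wpM2l a1' t2)))//.
by rewrite le_eqVlt; apply/orP; left; apply/eqP; ring.
Qed.

End ConvexAlongCurves.

Lemma hilbert_parallelogram (H : completeNormedModType R) (u v : H) :
  hilbert_space H ->
  `|u + v| ^+ 2 + `|u - v| ^+ 2 = 2 * (`|u| ^+ 2 + `|v| ^+ 2) :> R.
Proof.
move=> /hilbert_form[D [Dsym Dnorm _]].
pose b (w z : H) : R := D w z.
have bC w z : b w z = b z w by exact: Dsym.
have bD w z1 z2 : b w (z1 + z2) = b w z1 + b w z2.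
  by rewrite /b linearD; reflexivity.
have bN w z : b w (- z) = - b w z by rewrite /b linearN; reflexivity.
have bE w : `|w| ^+ 2 = b w w by exact/esym/Dnorm.
rewrite !bE !bD !(bC (_ + _)) !bD !bN !(bC (- _)) !bN (bC v u).
by ring.
Qed.

(** [q u] is the difference quotient at [x0], in the direction [u], of the convex function
    [f + K |. - x0|^2]. Its infimum [p] is sublinear, so a linear form below [p] is a subgradient;
    the claim is the case [t = 1]. *)
Lemma semiconvex_support (H : completeNormedModType R)
    (hilbertH : hilbert_space H) (f : H -> R) (x0 : H) (r L K : R) :
  0 < r -> 0 <= L -> 0 <= K ->
  (forall x y, `|x0 - x| < r -> `|x0 - y| < r -> `|f x - f y| <= L * `|x - y|) ->
  (forall x y a, `|x0 - x| < r -> `|x0 - y| < r -> 0 <= a <= 1 ->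
    f (a *: x + (1 - a) *: y) <=
      a * f x + (1 - a) * f y + K * (a * (1 - a) * `|x - y| ^+ 2)) ->
  exists l : 'L(H, R^o), forall v, `|v| < r ->
    f x0 + l v - K * `|v| ^+ 2 <= f (x0 + v).
Proof.
move=> r0 L0 K0 fL fK.
have [D [Dsym Dnorm DCS]] := hilbert_form hilbertH.
pose q u (t : R) := (f (x0 + t *: u) - f x0) / t + K * (t * `|u| ^+ 2).
pose dom (u : H) := [set t : R | 0 < t /\ t * `|u| < r].
pose Q u := [set q u t | t in dom u].
have x0b : `|x0 - x0| < r by rewrite subrr normr0.
have xK (w : H) : x0 + w - x0 = w by rewrite addrC addKr.
have inb u t : dom u t -> `|x0 - (x0 + t *: u)| < r.
  move=> [t0 tr]; rewrite opprD addNKr normrN normrZ gtr0_norm//.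
have domS u (s t : R) : dom u t -> 0 < s -> s <= t -> dom u s.
  by move=> [t0 tr] s0 st; split => //; rewrite (le_lt_trans _ tr)// ler_wpM2r.
have dom_ex u : exists t, dom u t.
  exists (r / (`|u| + 1)); have u1 : 0 < `|u| + 1 by rewrite ltr_wpDl.
  split; first by rewrite divr_gt0.
  by rewrite mulrAC ltr_pdivrMr// ltr_pM2l// ltrDl.
have q_ge u t : dom u t -> - (L * `|u|) <= q u t.
  move=> ut; have [t0 tr] := ut.
  have := fL _ _ (inb _ _ ut) x0b; rewrite xK normrZ gtr0_norm//.
  rewrite ler_norml => /andP[h _].
  have : - (L * `|u|) <= (f (x0 + t *: u) - f x0) / t.
    by rewrite ler_pdivlMr// mulNr mulrAC -mulrA.
  have : 0 <= K * (t * `|u| ^+ 2) by rewrite !mulr_ge0 ?exprn_ge0// ltW.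
  rewrite /q; lra.
have q_le u t : dom u t -> q u t <= (L + K * r) * `|u|.
  move=> ut; have [t0 tr] := ut.
  have := fL _ _ (inb _ _ ut) x0b; rewrite xK normrZ gtr0_norm//.
  rewrite ler_norml => /andP[_ h].
  have : (f (x0 + t *: u) - f x0) / t <= L * `|u|.
    by rewrite ler_pdivrMr// mulrAC -mulrA.
  have : K * (t * `|u| ^+ 2) <= K * r * `|u|.
    by rewrite -mulrA ler_wpM2l// expr2 mulrA ler_wpM2r// ltW.
  rewrite /q; lra.
have q_mono u s t : dom u t -> 0 < s -> s <= t -> q u s <= q u t.
  move=> ut s0 st; have [t0 tr] := ut.
  have a01 : 0 <= s / t <= 1.
    by rewrite divr_ge0 ?(ltW s0) ?(ltW t0)//= ler_pdivrMr// mul1r.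
  have := fK _ _ (s / t) (inb _ _ ut) x0b a01.
  have -> : (s / t) *: (x0 + t *: u) + (1 - s / t) *: x0 = x0 + s *: u.
    rewrite scalerDr scalerA divfK ?gt_eqF// addrAC -scalerDl.
    by rewrite (addrC (s / t)) subrK scale1r.
  rewrite xK normrZ gtr0_norm// exprMn => h.
  rewrite -(ler_pM2r s0) /q mulrDl divfK ?gt_eqF// mulrDl.
  have [a aE] : exists a, a = s / t by exists (s / t).
  have sE : s = a * t by rewrite aE divfK// gt_eqF.
  have -> : (f (x0 + t *: u) - f x0) / t * s = a * (f (x0 + t *: u) - f x0).
    by rewrite aE; ring.
  have -> : K * (s * `|u| ^+ 2) * s = K * (a * a * (t ^+ 2 * `|u| ^+ 2)).
    by rewrite {1 2}sE; ring.
  have -> : K * (t * `|u| ^+ 2) * s = K * (a * (t ^+ 2 * `|u| ^+ 2)).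
    by rewrite sE; ring.
  move: h; rewrite -aE; move: (f (x0 + t *: u)) (f (x0 + s *: u)) => *; lra.
(* [q u] is nondecreasing by semiconvexity, hence [p u] is the directional derivative
   of [f] at [x0]. *)
pose p u := inf (Q u).
have Q_inf u : has_inf (Q u).
  split; first by have [t ut] := dom_ex u; exists (q u t), t.
  by exists (- (L * `|u|)) => _ [t ut <-]; exact: q_ge.
have p_le u t : dom u t -> p u <= q u t.
  by move=> ut; apply: (ge_inf (Q_inf u).2); exists t.
have le_p u b : (forall t, dom u t -> b <= q u t) -> b <= p u.
  move=> bq; apply: lb_le_inf; first exact: (Q_inf u).1.
  by move=> _ [t ut <-]; exact: bq.
have [||||z zP] := @coercive_sublinear_minorant _ H D 1 ltr01 Dsym _ p (L + K * r).
- by move=> v; rewrite mul1r Dnorm.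
(* By monotonicity both quotients may be taken at one time [2 * s]. The midpoint of [x0 + 2 s u] and
   [x0 + 2 s v] is [x0 + s (u + v)], and the parallelogram identity absorbs the quadratic terms. *)
- move=> u v; rewrite -lerBlDr; apply/le_p => t ut; rewrite lerBlDl -lerBlDr.
  apply/le_p => t' vt'; rewrite lerBlDr [leRHS]addrC.
  have [t0 _] := ut; have [t0' _] := vt'.
  pose s := Num.min t t' / 2; have s0 : 0 < s by rewrite divr_gt0// lt_min t0.
  have s20 : 0 < 2 * s by rewrite mulr_gt0.
  have s2E : 2 * s = Num.min t t' by rewrite /s mulrC divfK.
  have st : 2 * s <= t by rewrite s2E ge_min lexx.
  have st' : 2 * s <= t' by rewrite s2E ge_min lexx orbT.
  have us := domS _ _ _ ut s20 st; have vs := domS _ _ _ vt' s20 st'.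
  have uvs : dom (u + v) s.
    split => //; have := ler_wpM2l (ltW s0) (ler_normD u v).
    by move: us.2 vs.2; lra.
  rewrite (le_trans (p_le _ _ uvs))// (@le_trans _ _ (q u (2 * s) + q v (2 * s)))//;
    last by rewrite lerD// q_mono.
  have h01 : 0 <= (2^-1 : R) <= 1 by rewrite invr_ge0 ler0n invf_le1 ?ler1n.
  have := fK _ _ _ (inb _ _ us) (inb _ _ vs) h01.
  have -> : 2^-1 *: (x0 + (2 * s) *: u) + (1 - 2^-1) *: (x0 + (2 * s) *: v) =
      x0 + s *: (u + v).
    rewrite (_ : 1 - 2^-1 = 2^-1 :> R); last by field.
    rewrite !scalerDr !scalerA mulKf// addrACA -scalerDl.
    by rewrite (_ : 2^-1 + 2^-1 = 1) ?scale1r//; field.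
  rewrite opprD addrACA subrr add0r -scalerBr normrZ gtr0_norm// exprMn.
  have := hilbert_parallelogram u v hilbertH.
  have e w : q w (2 * s) * s =
      (f (x0 + (2 * s) *: w) - f x0) / 2 + K * (2 * s * `|w| ^+ 2) * s.
    by rewrite /q; field; rewrite gt_eqF.
  have e' w : q w s * s = f (x0 + s *: w) - f x0 + K * (s * `|w| ^+ 2) * s.
    by rewrite /q; field; rewrite gt_eqF.
  move=> par h; rewrite -(ler_pM2r s0) [leRHS]mulrDl !e e'; move: par h.
  move: (f _) (f _) (f _) (f _) (`|u + v| ^+ 2) (`|u - v| ^+ 2).
  move=> fuv fu fv f0 U V.
  move=> UV; have -> : V = 2 * (`|u| ^+ 2 + `|v| ^+ 2) - U by rewrite -UV; ring.
  lra.
- move=> a u a0.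
  (* One inequality for every positive factor is enough: the converse is the same inequality for the
     factor [a^-1] at [a *: u]. *)
  have half (b : R) w : 0 < b -> b * p w <= p (b *: w).
    move=> b0; apply/le_p => t [t0 wt].
    have wbt : dom w (t * b).
      by split; rewrite ?mulr_gt0//; move: wt; rewrite normrZ gtr0_norm// mulrA.
    have -> : q (b *: w) t = b * q w (t * b).
      by rewrite /q scalerA normrZ (gtr0_norm b0); field; rewrite !gt_eqF.
    by rewrite ler_pM2l// p_le.
  apply/eqP; rewrite eq_le half// andbT.
  have ai0 : 0 < a^-1 by rewrite invr_gt0.
  have := half _ (a *: u) ai0; rewrite scalerA mulVf ?gt_eqF// scale1r.
  by rewrite ler_pdivrMl.
- by move=> u; have [t ut] := dom_ex u; rewrite (le_trans (p_le _ _ ut))// q_le.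
exists (- D z) => v vr.
have dom1 : dom v 1 by split; rewrite ?mul1r.
have := le_trans (zP v) (p_le _ _ dom1).
rewrite /q scale1r divr1 mul1r.
have -> : (- D z) v = - D z v :> R by reflexivity.
move: (D z v : R) (f (x0 + v)) (f x0) (K * `|v| ^+ 2) => *; lra.
Qed.

End CurveConvexity.

(** * Subdifferentiability on the manifold *)

Section Manifold.
Context {R : realType}.
Implicit Types V W : normedModType R.

(** Taylor estimate for [x |-> max(0, x)^2], whose derivative [2 max(0, x)] is 2-Lipschitz. *)
Lemma sqr_max0_remainder (a k : R) :
  `|Num.max 0 (a + k) ^+ 2 - Num.max 0 a ^+ 2 - 2 * Num.max 0 a * k| <= k ^+ 2.
Proof.
rewrite ler_norml; have [ak|ak] := leP 0 (a + k); have [a0|a0] := leP 0 a.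
all: by apply/andP; split; nra.
Qed.

Lemma is_diff_quadratic V W (f : V -> W) (L : 'L(V, W)) x C : 0 <= C ->
  (forall h, `|h| <= 1 -> `|f (h + x) - f x - L h| <= C * `|h| ^+ 2) ->
  is_diff x f L.
Proof.
move=> C0 fC; apply: is_diff_intro; [exact: contlin_linear|exact: contlin_continuous|].
move=> e e0; have C1 : 0 < C + 1 by rewrite ltr_wpDl.
have d0 : 0 < Num.min 1 (e / (C + 1)) by rewrite lt_min ltr01 divr_gt0.
apply: filterS (nbhsx_ballx 0 _ d0) => h.
rewrite -ball_normE/= sub0r normrN lt_min ltr_pdivlMr// => /andP[h1 he].
rewrite (le_trans (fC _ (ltW h1)))// expr2 mulrA ler_wpM2r//.
by rewrite mulrC (le_trans _ (ltW he))// ler_wpM2l// lerDl.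
Qed.

(** To be read with [B] the product of [w] and [v], [W = |w|] and [Y = |v|]. Expanding the square at
    [h0 = r^2 / 4] gives [- 2 lam h0 Y^2] and [lam k^2 <= lam h0 Y^2]; what remains is at most
    [- (K + 1) Y^2]. *)
Lemma bump_touch_aux (K r lam B W Y : R) : 0 <= K -> 0 < r ->
  0 < lam -> 0 <= Y -> `|B| <= W * Y -> 8 * W <= r ->
  K + 1 <= lam * (r ^+ 2 / 4) -> Y <= r / 4 ->
  lam * (r ^+ 2 / 4 + (2 * B - Y ^+ 2)) ^+ 2 <=
    lam * (r ^+ 2 / 4) ^+ 2 + 4 * lam * (r ^+ 2 / 4) * B - K * Y ^+ 2.
Proof.
move=> K0 r0 lam0 Y0 BWY Wr Klam Yr; set k := 2 * B - Y ^+ 2.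
have kY : `|k| <= r / 2 * Y.
  rewrite (le_trans (ler_normB _ _))// normrM normr_nat (ger0_norm (sqr_ge0 Y)).
  have : W * Y <= r / 8 * Y by rewrite ler_wpM2r//; lra.
  have : Y ^+ 2 <= r / 4 * Y by rewrite expr2 ler_wpM2r.
  by move: BWY; lra.
have k2 : k ^+ 2 <= r ^+ 2 / 4 * Y ^+ 2.
  have -> : r ^+ 2 / 4 * Y ^+ 2 = (r / 2 * Y) ^+ 2 by field.
  rewrite -real_normK ?num_real// ler_pXn2r ?nnegrE//.
  by rewrite mulr_ge0// divr_ge0// ltW.
have lk : lam * k ^+ 2 <= lam * (r ^+ 2 / 4) * Y ^+ 2.
  by rewrite -mulrA ler_wpM2l// ltW.
have KY : (K + 1) * Y ^+ 2 <= lam * (r ^+ 2 / 4) * Y ^+ 2.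
  by rewrite ler_wpM2r// exprn_ge0.
have Y20 : 0 <= Y ^+ 2 by rewrite exprn_ge0.
move: lk KY Y20; rewrite /k; lra.
Qed.

(** [p] is the remainder of [sqr_max0_remainder] for the increment [2 B - V^2]. Only the part [2 B]
    is linear, so [V^2] joins the error with the factor [2 M]. *)
Lemma bump_remainder_aux (p M B Y V : R) : `|p| <= (2 * B - V ^+ 2) ^+ 2 ->
  `|B| <= Y * V -> 0 <= V -> V <= 1 -> 0 <= Y -> 0 <= M ->
  `|p - 2 * M * V ^+ 2| <= ((2 * Y + 1) ^+ 2 + 2 * M) * V ^+ 2.
Proof.
move=> pB BYV V0 V1 Y0 M0.
have k : `|2 * B - V ^+ 2| <= (2 * Y + 1) * V.
  rewrite (le_trans (ler_normB _ _))// normrM normr_nat (ger0_norm (sqr_ge0 V)).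
  have : V ^+ 2 <= V by rewrite expr2 ler_piMr.
  by move: BYV; lra.
have k2 : (2 * B - V ^+ 2) ^+ 2 <= (2 * Y + 1) ^+ 2 * V ^+ 2.
  rewrite -exprMn -real_normK ?num_real// ler_pXn2r ?nnegrE//.
  by rewrite mulr_ge0// addr_ge0// mulr_ge0.
have MV : `|2 * M * V ^+ 2| = 2 * M * V ^+ 2.
  by rewrite ger0_norm// mulr_ge0 ?exprn_ge0// mulr_ge0.
rewrite (le_trans (ler_normB _ _))// MV [leRHS]mulrDl lerD2r.
exact: le_trans pB k2.
Qed.

(** Completing the square, [h x = h0 + |w|^2 - |x - x0 - w|^2]: the positive part of [h] lives on a
    ball around [x0 + w], and its square is of class [C^1]. A large factor [lam] supplies the
    curvature below [- K] at [x0]. *)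
Lemma touching_bump (H : completeNormedModType R) (hilbertH : hilbert_space H)
    (l : 'L(H, R^o)) (x0 : H) (K r : R) : 0 <= K -> 0 < r ->
  exists psi : H -> R^o, exists psi' : H -> 'L(H, R^o),
  [/\ forall x, is_diff x psi (psi' x), continuous psi',
    forall x, r <= `|x0 - x| -> psi x = 0 /\ psi' x = 0 &
    exists2 d, 0 < d & forall v, `|v| <= d ->
      psi (x0 + v) <= psi x0 + l v - K * `|v| ^+ 2].
Proof.
move=> K0 r0; have aux := bump_touch_aux K0 r0.
have [D [Dsym Dnorm DCS]] := hilbert_form hilbertH.
have [z zE] := riesz Dsym Dnorm l.
pose h0 := r ^+ 2 / 4; have h00 : 0 < h0 by rewrite divr_gt0// exprn_gt0.
(* The first term gives [K + 1 <= lam * h0], which is the curvature; the second gives [8 |w| <= r],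
   which is the support. *)
pose lam := (K + 1) / h0 + 2 * `|z| / (h0 * r).
have rN0 : r != 0 by rewrite gt_eqF.
have h0N0 : h0 != 0 by rewrite gt_eqF.
have lamh : lam * (h0 * r) = (K + 1) * r + 2 * `|z|.
  by rewrite /lam; field; rewrite h0N0 rN0.
have lam1 : K + 1 <= lam * h0.
  by rewrite -(ler_pM2r r0) -mulrA lamh lerDl mulr_ge0.
have lam0 : 0 < lam by rewrite -(pmulr_lgt0 _ h00) (lt_le_trans _ lam1)// ltr_wpDl.
have lam2 : 2 * `|z| <= lam * (h0 * r).
  by rewrite lamh lerDr mulr_ge0 ?(ltW r0)// ltW// ltr_wpDl.
(* The scaling of [w] makes [l] the derivative of [psi] at [x0]; the large [lam]
   makes [w] small, which puts the support of [psi] in the ball. *)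
pose w := (4 * lam * h0)^-1 *: z.
have lh0 : 0 < 4 * lam * h0 by rewrite !mulr_gt0.
have wr : 8 * `|w| <= r.
  rewrite normrZ gtr0_norm ?invr_gt0// mulrCA ler_pdivrMl//.
  by move: lam2; lra.
pose b (u v : H) : R := D u v.
have bC u v : b u v = b v u by exact: Dsym.
have bDr u v1 v2 : b u (v1 + v2) = b u v1 + b u v2.
  by rewrite /b contlinrD; reflexivity.
have bBr u v1 v2 : b u (v1 - v2) = b u v1 - b u v2.
  by rewrite /b contlinrB; reflexivity.
have bl v : 4 * lam * h0 * b w v = l v.
  have -> : b w v = (4 * lam * h0)^-1 * b z v.
    by rewrite /b contlinrZ; reflexivity.
  by rewrite mulVKf ?gt_eqF// /b zE.
have bCS u v : `|b u v| <= `|u| * `|v| by exact: DCS.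
have bnorm u : b u u = `|u| ^+ 2 by exact: Dnorm.
pose h x := h0 + 2 * b w (x - x0) - `|x - x0| ^+ 2.
pose m x := Num.max 0 (h x).
have m0 x : 0 <= m x by rewrite le_max lexx.
pose psi x : R^o := lam * m x ^+ 2.
pose psi' x : 'L(H, R^o) := (lam * (2 * m x) * 2) *: D (w - (x - x0)).
have hD v x : h (v + x) = h x + (2 * b (w - (x - x0)) v - `|v| ^+ 2).
  rewrite /h; have -> : v + x - x0 = v + (x - x0) by rewrite addrA.
  move: (x - x0) => y; rewrite -!bnorm !bDr (bC (v + y) v) (bC (v + y) y) !bDr.
  by rewrite (bC (w - y) v) bBr (bC y v) (bC v w); ring.
have psi'E x v : psi' x v = lam * (2 * m x) * 2 * b (w - (x - x0)) v :> R.
  by rewrite /psi' contlinZE.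
exists psi, psi'; split.
- move=> x; pose y := w - (x - x0).
  apply: (@is_diff_quadratic _ _ _ _ _ (lam * ((2 * `|y| + 1) ^+ 2 + 2 * m x))).
    by rewrite mulr_ge0 ?(ltW lam0)// addr_ge0 ?exprn_ge0 ?mulr_ge0// addr_ge0 ?mulr_ge0.
  move=> v v1; have := sqr_max0_remainder (h x) (2 * b y v - `|v| ^+ 2).
  rewrite -hD -/(m x) -/(m _) => rem.
  have -> : psi (v + x) - psi x - psi' x v = lam *
     ((m (v + x) ^+ 2 - m x ^+ 2 - 2 * m x * (2 * b y v - `|v| ^+ 2))
      - 2 * m x * `|v| ^+ 2) :> R by rewrite psi'E /psi; ring.
  rewrite normrM (gtr0_norm lam0) -[leRHS]mulrA ler_wpM2l ?(ltW lam0)//.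
  exact: bump_remainder_aux rem (bCS y v) (normr_ge0 _) v1 (normr_ge0 _) (m0 x).
- have sub_cont : continuous (fun x : H => x - x0).
    by move=> x; apply: cvgB; [exact: cvg_id|exact: cvg_cst].
  have norm_cont : continuous (fun x : H => `|x - x0| : R^o).
    move=> x; apply: (@continuous_comp _ _ _ (fun x : H => x - x0)).
      exact: sub_cont.
    exact: norm_continuous.
  have h_cont : continuous (h : H -> R^o).
    move=> x; rewrite /h; apply: cvgB; last first.
      by apply: cvgM; exact: norm_cont.
    apply: cvgD; first exact: cvg_cst.
    apply: cvgM; first exact: cvg_cst.
    apply: (@continuous_comp _ _ _ (fun x : H => x - x0)); first exact: sub_cont.
    exact: contlin_continuous.
  have m_cont : continuous (m : H -> R^o).
    move=> x; apply: (@continuous_max _ _ (fun=> 0) h); last exact: h_cont.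
    exact: cst_continuous.
  move=> x; apply: cvgZ.
    apply: cvgM; last exact: cvg_cst.
    apply: cvgM; first exact: cvg_cst.
    by apply: cvgM; [exact: cvg_cst|exact: m_cont].
  apply: (@continuous_comp _ _ _ (fun x : H => w - (x - x0))).
    by apply: cvgB; [exact: cvg_cst|exact: sub_cont].
  exact: contlin_continuous.
- move=> x xr; suff hx : h x <= 0.
    have mx : m x = 0 by apply: max_idPl.
    split; first by rewrite /psi mx expr0n/= mulr0.
    by rewrite /psi' mx !mulr0 mul0r scale0r.
  move: xr; rewrite distrC; set y := x - x0 => yr.
  have := bCS w y; rewrite ler_norml => /andP[_].
  rewrite /h -/y /h0; move: (b w y) `|w| `|y| (normr_ge0 w) wr yr r0.
  clear; move=> B W Y W0 Wr rY r0 BWY.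
  have : W * Y <= r / 8 * Y by rewrite ler_wpM2r; lra.
  nra.
exists (r / 4); first by rewrite divr_gt0.
move=> v vr; have [psi0 psiv] : psi x0 = lam * h0 ^+ 2 /\
   psi (x0 + v) <= lam * (h0 + (2 * b w v - `|v| ^+ 2)) ^+ 2.
  have h_x0 : h x0 = h0 by rewrite /h subrr normr0 -(subrr 0) bBr !subrr; ring.
  split; first by rewrite /psi /m h_x0 max_r// ltW.
  have -> : h0 + (2 * b w v - `|v| ^+ 2) = h (x0 + v).
    by rewrite (addrC x0) hD h_x0 subrr subr0.
  rewrite /psi ler_wpM2l ?(ltW lam0)// /m.
  by have [h_le0|h_ge0] := leP (h (x0 + v)) 0; rewrite ?expr0n/= ?sqr_ge0.
rewrite (le_trans psiv)// psi0 -bl.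
exact: aux lam0 (normr_ge0 v) (bCS w v) wr lam1 vr.
Qed.

(** The two curves agree on [I] only: reading a curve back in a chart recovers it only while it
    stays in the codomain of the chart. *)
Lemma derivative_within_is_derive (H : completeNormedModType R) (I : set R)
    (c d : R -> H) (t : R) (v : H) :
  is_derive t 1 c v -> I t -> (forall s, I s -> d s = c s) ->
  derivative_within I d t v.
Proof.
move=> /is_derive1_diff/is_diff_near cv It dc.
apply/cvgrPdist_le => e e0; have := cv e e0.
move=> /nbhs_ballP[r /= r0 rP]; rewrite !near_withinE.
apply: filterS (nbhsx_ballx t _ r0) => s ts st sI.
have st0 : s - t != 0 by rewrite subr_eq0.
have := rP (s - t); rewrite -ball_normE/= sub0r normrN subrK distrC.
rewrite -(dc _ sI) -(dc _ It); move: ts; rewrite -ball_normE => ts /(_ ts) h.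
rewrite distrC -[v](scalerK st0) -scalerBr normrZ normfV.
by rewrite ler_pdivrMl ?normr_gt0// mulrC (distrC s).
Qed.

Lemma is_diff_eq_near V W (f g : V -> W) x (L : 'L(V, W)) :
  (\forall y \near x, f y = g y) -> is_diff x f L -> is_diff x g L.
Proof.
move=> fg /is_diff_near df.
apply: is_diff_intro; [exact: contlin_linear|exact: contlin_continuous|].
move=> e /df; have [r /= r0 rP] := (nbhs_ballP _ _).1 fg.
apply: filterS2 (nbhsx_ballx 0 _ r0) => h; rewrite -ball_normE/= sub0r normrN => hr.
rewrite -(rP x (ballxx x r0)) -(rP (h + x))//.
by rewrite -ball_normE/= opprD addrCA subrr addr0 normrN.
Qed.

Lemma contlin_comp_subproof V W Z (A : 'L(W, Z)) (B : 'L(V, W)) :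
  A \o B \in continuous_linear.
Proof.
rewrite inE; split=> [k x y|x /=]; first by rewrite /= !contlin_linear.
by apply: continuous_comp; exact: contlin_continuous.
Qed.

Definition contlin_comp V W Z (A : 'L(W, Z)) (B : 'L(V, W)) : 'L(V, Z) :=
  Contlin (contlin_comp_subproof A B).

Lemma contlin_comp_dist_le V W Z (A A' : 'L(W, Z)) (B B' : 'L(V, W)) :
  `|contlin_comp A B - contlin_comp A' B'| <=
    `|A - A'| * `|B| + `|A'| * `|B - B'|.
Proof.
apply: contlin_norm_le => [|x]; first by rewrite addr_ge0// mulr_ge0.
have -> : (contlin_comp A B - contlin_comp A' B') x = (A - A') (B x) + A' ((B - B') x).
  by rewrite !contlinBE contlinrB addrA subrK; reflexivity.
rewrite mulrDl -!mulrA (le_trans (ler_normD _ _))// lerD//.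
  by rewrite (le_trans (ler_contlin _ _))// ler_wpM2l// ler_contlin.
by rewrite (le_trans (ler_contlin _ _))// ler_wpM2l// ler_contlin.
Qed.

Lemma continuous_contlin_comp (T : topologicalType) V W Z
    (A : T -> 'L(W, Z)) (B : T -> 'L(V, W)) t :
  {for t, continuous A} -> {for t, continuous B} ->
  {for t, continuous (fun s => contlin_comp (A s) (B s))}.
Proof.
move=> cA cB.
have h : `|A t - A s| * `|B t| + `|A s| * `|B t - B s| @[s --> t] --> (0 : R).
  have -> : 0 = `|A t - A t| * `|B t| + `|A t| * `|B t - B t| :> R.
    by rewrite !subrr !normr0 mulr0 mul0r addr0.
  apply: cvgD.
    by apply: cvgM; [apply: cvg_norm; apply: cvgB => //|]; exact: cvg_cst.
  by apply: cvgM; apply: cvg_norm => //; apply: cvgB => //; exact: cvg_cst.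
apply/cvgrPdist_lt => e e0; have /cvgrPdist_lt/(_ e e0) := h.
apply: filterS => s; rewrite sub0r normrN => /(le_lt_trans (ler_norm _)).
exact/le_lt_trans/contlin_comp_dist_le.
Qed.

(** * From one chart to the manifold *)

Section ManifoldGeodesics.
Context {H : completeNormedModType R} {M : topologicalType}.

Lemma chart_codomP (a : chart H M) x : chart_codom a x ->
  chart_dom a (chart_inv a x) /\ a (chart_inv a x) = x.
Proof. by case=> q aq <-; rewrite chart_mapK ?mem_set. Qed.

Variable X : riemannian H M.

Lemma geodesic_chart_curve (a : chart H M) (tau : R) (s s1 s2 : R -> H) :
  atlas X a ->
  (forall t : R, `|t| < tau -> [/\ chart_codom a (s t),
    is_derive t 1 s (s1 t), is_derive t 1 s1 (s2 t),
    christoffel (metric X a) (s t) (s1 t) (s1 t) (- s2 t) &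
    metric X a (s t) (s1 t) (s1 t) = 1 :> R]) ->
  geodesic X [set t : R | `|t| < tau] (chart_inv a \o s).
Proof.
move=> Xa sP t tt; exists a => //; exists s1, s2.
have aE u : `|u| < tau -> a (chart_inv a (s u)) = s u.
  by move=> /sP[/chart_codomP[]].
rewrite near_withinE; apply: nearW => u /= ut; have [su d1 d2 chr unit] := sP u ut.
have [domu _] := chart_codomP su.
split => //.
- exact: derivative_within_is_derive d1 ut aE.
- exact: derivative_within_is_derive d2 ut _.
- by rewrite aE.
- by rewrite aE.
Qed.

(** Geodesics have unit speed for the metric, while the directions [e] have norm 1 in [H]: time is
    rescaled by the metric length [k] of [e]. As [k <= K + 1] and [k^2 <= K], the time becomes
    [tau / (K + 1)] and the deviation constant [N * K]. *)
Lemma convex_chart_curves (hilbertH : hilbert_space H) (g : M -> R) (a : chart H M)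
    (x0 : H) : continuous g -> geodesically_convex X g -> atlas X a ->
  chart_codom a x0 -> exists rho tau N : R, [/\ 0 < rho, 0 < tau, 0 <= N,
    forall x, `|x0 - x| < rho ->
      chart_codom a x /\ {for x, continuous (g \o chart_inv a)} &
    forall x e, `|x0 - x| < rho -> `|e| = 1 -> exists2 c : R -> H,
      forall t : R, `|t| < tau -> `|c t - x - t *: e| <= N * t ^+ 2 &
      forall s t b : R, `|s| < tau -> `|t| < tau -> 0 <= b <= 1 ->
        (g \o chart_inv a) (c (b * s + (1 - b) * t)) <=
        b * (g \o chart_inv a) (c s) + (1 - b) * (g \o chart_inv a) (c t)].
Proof.
move=> cg g_convex Xa ax0.
have [c0 [C0 [c00 _ G0]]] := metric_equiv Xa ax0.
have Gc0 v : c0 * `|v| ^+ 2 <= metric X a x0 v v by case/andP: (G0 v).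
have [r [c [K [tau [N [[r0 c_gt0 K0 tau0 N0] [rU Gx geo]]]]]]] :=
  chart_geodesics hilbertH (@chart_codom_open _ _ _ a) ax0 (metric_smooth Xa 2)
    (Defs.metric_sym Xa) c00 Gc0.
have half_r : r / 2 <= r by rewrite ler_pdivrMr// ler_pMr// ler1n.
exists (r / 2), (tau / (K + 1)), (N * K).
have K1 : 0 < K + 1 by rewrite addr_gt0.
split; [by rewrite divr_gt0|by rewrite divr_gt0|by rewrite mulr_ge0// ltW| |].
  move=> x xr; have ax : chart_codom a x.
    by apply: rU; rewrite -ball_normE/= (lt_le_trans xr).
  split => //; apply: continuous_comp; last exact: cg.
  exact: chart_inv_continuous.
move=> x e xr e1.
have [xb xb2] : ball x0 (r / 2) x /\ ball x0 r x.
  by split; rewrite -ball_normE//=; exact: lt_le_trans xr half_r.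
have := Gx x e xb2; rewrite e1 expr1n !mulr1 => /andP[cG GK].
pose k := Num.sqrt (metric X a x e e : R).
have G_gt0 : 0 < (metric X a x e e : R) by exact: lt_le_trans cG.
have k0 : 0 < k by rewrite sqrtr_gt0.
have k2 : k ^+ 2 = metric X a x e e by rewrite sqr_sqrtr// ltW.
have kK : k <= K + 1.
  have : k ^+ 2 <= K by rewrite k2.
  by move: k0 K0; nra.
have Gv : metric X a x (k^-1 *: e) (k^-1 *: e) = 1 :> R.
  have -> : metric X a x (k^-1 *: e) (k^-1 *: e) =
      k^-1 * (k^-1 * metric X a x e e) :> R.
    by rewrite !contlinrZ contlinZE; reflexivity.
  by rewrite -k2 expr2 mulKf ?gt_eqF// mulVf// gt_eqF.
have [s [s1 [s2 sP]]] := geo x (k^-1 *: e) xb Gv.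
have geod : geodesic X [set t : R | `|t| < tau] (chart_inv a \o s).
  apply: (geodesic_chart_curve Xa (s1 := s1) (s2 := s2)) => t /sP[st _ d1 d2 [chr un]].
  by split => //; exact: rU.
have ktau t : `|t| < tau / (K + 1) -> `|t * k| < tau.
  rewrite ltr_pdivlMr// normrM (gtr0_norm k0); apply: le_lt_trans.
  by rewrite ler_wpM2l.
exists (fun t => s (t * k)).
  move=> t /ktau/sP[_ h _ _ _]; move: h.
  rewrite scalerA mulfK ?gt_eqF// => /le_trans; apply.
  have kK2 : k ^+ 2 <= K by rewrite k2.
  by rewrite exprMn -mulrA ler_wpM2l// (mulrC K) ler_wpM2l// sqr_ge0.
move=> u t b /ktau ut /ktau tt b01.
have I_itv : is_interval [set t : R | `|t| < tau].
  move=> y z /=; rewrite !ltr_norml => /andP[y1 y2] /andP[z1 z2] w /andP[yw wz].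
  by rewrite ltr_norml (lt_le_trans y1 yw) (le_lt_trans wz z2).
have cvx := g_convex _ _ I_itv geod.
move: b01 => /andP[b0 b1].
have := cvx (Itv01 b0 b1) (u * k) (t * k) (mem_set ut) (mem_set tt).
rewrite !convRE /= => h; have -> : (b * u + (1 - b) * t) * k =
  b * (u * k) + (1 - b) * (t * k) by ring.
exact: h.
Qed.

(* Join [q'] to [q] by a segment of a chart [b] at [q]. As the two expressions of the
   metric agree, this curve is short in [a], so it stays in a ball where [a] is well
   behaved; by the Hausdorff property it cannot leave [chart_dom a], and so [q] is in
   the domain. *)
Lemma chart_separation (a : chart H M) (x0 : H) : hilbert_space H ->
  atlas X a -> chart_codom a x0 -> exists2 r : R, 0 < r &
  forall q, ~ chart_dom a q ->
    \forall q' \near q, chart_dom a q' -> r <= `|x0 - a q'|.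
Proof.
move=> hilbertH Xa ax0.
have [D [Dsym Dnorm DCS]] := hilbert_form hilbertH.
have mvH := mean_value_space_hilbert Dnorm DCS.
have bounds (b : chart H M) y : atlas X b -> chart_codom b y ->
    exists r c K : R, [/\ 0 < r, 0 < c, 0 < K & forall x, `|y - x| < r ->
      chart_codom b x /\ forall v, c * `|v| ^+ 2 <= metric X b x v v <= K * `|v| ^+ 2].
  move=> Xb bY; have [c0 [C0 [c00 _ G0]]] := metric_equiv Xb bY.
  have Gc0 v : c0 * `|v| ^+ 2 <= metric X b y v v by case/andP: (G0 v).
  have [r [c [K [tau [N [[r0 c_gt0 K0 _ _] [rU Gx _]]]]]]] :=
    chart_geodesics hilbertH (@chart_codom_open _ _ _ b) bY (metric_smooth Xb 2)
      (Defs.metric_sym Xb) c00 Gc0.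
  exists r, c, K; split => // x xr; have xb : ball y r x by rewrite -ball_normE.
  by split=> [|v]; [exact: rU|exact: Gx].
have [R0 [c [Ka [R00 c0 _ Ga]]]] := bounds a x0 Xa ax0.
pose r := R0 / 4; have r0 : 0 < r by rewrite divr_gt0.
have rR : 2 * r < R0 by rewrite /r; move: R00; lra.
exists r => // q Naq.
have [b Xb bq] := atlas_cover X q.
have bbq : chart_codom b (b q) by exists q.
have [rb [cb [K [rb0 _ K0 Gb]]]] := bounds b (b q) Xb bbq.
set y0 := b q in bbq Gb.
(* With [K d^2 <= c (r / 2)^2], a segment shorter than [d] in [b] has speed at most [r / 2] in [a];
   starting within [r] of [x0], it stays within [2 * r], which is less than [R0]. *)
pose d := Num.min rb (Num.min 1 (c * (r / 2) ^+ 2 / K)).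
have r20 : 0 < r / 2 by rewrite divr_gt0.
have d0 : 0 < d by rewrite !lt_min rb0 ltr01 divr_gt0// mulr_gt0// exprn_gt0.
have drb : d <= rb by rewrite ge_min lexx.
have d2 : K * d ^+ 2 <= c * (r / 2) ^+ 2.
  have d1 : d <= 1 by rewrite !ge_min lexx orbT.
  have : d <= c * (r / 2) ^+ 2 / K by rewrite !ge_min lexx !orbT.
  rewrite ler_pdivlMr// mulrC; apply: le_trans; rewrite ler_wpM2l ?(ltW K0)//.
  by rewrite expr2 ler_piMr// ltW.
have nb : \forall q' \near q, chart_dom b q' /\ `|y0 - b q'| < d.
  apply: filterI; first by apply: open_nbhs_nbhs; split => //; exact: chart_dom_open.
  by have /cvgrPdist_lt := chart_map_continuous bq; apply.
apply: filterS nb => q' [bq' q'd] aq'; rewrite leNgt; apply/negP => q'r; apply: Naq.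
set y1 := b q' in q'd.
pose u := y0 - y1; pose y (t : R) := y1 + t *: u.
pose gam t := chart_inv b (y t); pose e t := a (gam t).
have yd (t : R) : 0 <= t <= 1 -> `|y0 - y t| < d.
  move=> t01; have y0b : ball y0 d y0 by exact: ballxx.
  have y1b : ball y0 d y1 by rewrite -ball_normE.
  by have := ball_segment y0b y1b t01; rewrite -ball_normE.
have yb (t : R) : 0 <= t <= 1 -> chart_codom b (y t) /\
    forall v, metric X b (y t) v v <= K * `|v| ^+ 2.
  move=> /yd td; have [? h] := Gb _ (lt_le_trans td drb).
  by split=> // v; case/andP: (h v).
pose good t := chart_dom a (gam t) /\ `|x0 - e t| < 2 * r.
have dy (t : R) : is_derive t 1 y u := is_derive1_affine y1 u t.
have gam_cont (t : R) : 0 <= t <= 1 -> {for t, continuous gam}.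
  move=> /yb[yt _]; apply: continuous_comp; last exact: chart_inv_continuous.
  exact: is_derive1_continuous (dy t).
have de (t : R) : 0 <= t <= 1 -> good t ->
    exists2 v, is_derive t 1 e v & `|v| <= r / 2.
  move=> t01 [at_ et]; have [/chart_codomP[bt bgt] Gbt] := yb t t01.
  have ov : chart_overlap b a (y t) by exists (gam t).
  have [T' [dT _]] := atlas_smooth Xb Xa 1.
  exists (T' (y t) u); first exact: is_derive1_comp (dT _ ov) (dy t).
  have := metric_change Xb Xa ov u u.
  have [_ ->] := dT _ ov => mE.
  have [_ /(_ (T' (y t) u))/andP[h _]] := Ga _ (lt_trans et rR).
  have h1 : c * `|T' (y t) u| ^+ 2 <= K * `|u| ^+ 2.
    by rewrite (le_trans h)// -mE.
  rewrite -(@ler_pXn2r _ 2)// ?nnegrE ?(ltW r20)// -(ler_pM2l c0).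
  rewrite (le_trans h1)// (le_trans _ d2)// ler_wpM2l ?(ltW K0)//.
  by rewrite ler_pXn2r ?nnegrE// ltW.
have good0 : good 0.
  rewrite /good /e /gam /y scale0r addr0 /y1 (chart_mapK (mem_set bq')).
  by split=> //; rewrite (lt_trans q'r)//; move: r0; lra.
(* Continuity argument: the supremum of the times up to which the curve is good is itself good, and
   being good is an open condition, so this supremum is 1, where the curve is at [q]. *)
pose S := [set t : R | 0 <= t <= 1 /\ forall s, 0 <= s <= t -> good s].
have S0 : S 0.
  split; first by rewrite lexx ler01.
  by move=> s s0; rewrite (_ : s = 0)//; exact/esym/le_anti.
have S_sup : has_sup S by split; [exists 0|exists 1 => t [/andP[_]]].
pose T := sup S.
have T0 : 0 <= T by exact: ub_le_sup S_sup.2 _ S0.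
have T1 : T <= 1 by apply: ge_sup; [exists 0|move=> t [/andP[_]]].
have below (t : R) : 0 <= t -> t < T -> good t.
  move=> t0 tT; have Tt : 0 < T - t by rewrite subr_gt0.
  have [t' [_ St']] := sup_adherent Tt S_sup; rewrite subKr => tt'.
  by apply: St'; rewrite t0 ltW.
have in01 (s t : R) : 0 <= s -> t < T -> s <= t -> 0 <= s <= 1.
  by move=> -> tT st; rewrite (le_trans st)// (le_trans (ltW tT)).
have lip (s t : R) : 0 <= s -> s <= t -> t < T -> `|e t - e s| <= r / 2 * (t - s).
  move=> s0 st tT.
  have /choice[e' e'P] z : exists v, s <= z <= t -> is_derive z 1 e v /\ `|v| <= r / 2.
    have [/andP[sz zt]|] := pselect (s <= z <= t); last by exists 0.
    have z0 := le_trans s0 sz; have zT := le_lt_trans zt tT.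
    have [v ? ?] := de z (in01 z z z0 zT (lexx z)) (below z z0 zT).
    by exists v.
  by apply: (mvH e e' s t _ st) => z /e'P[].
(* The Lipschitz bound gives [e] a limit [l] in the codomain of [a] as time tends to [T]. The curve
   in [M] then tends both to [gam T] and to [chart_inv a l], which agree since [M] is Hausdorff. *)
have goodT : good T.
  have [T00|TN0] := eqVneq T 0; first by rewrite T00.
  have T_gt0 : 0 < T by rewrite lt_def TN0.
  pose t_ n : R := T - T / n.+1%:R.
  have tn0 n : 0 <= t_ n by rewrite subr_ge0 ler_pdivrMr// ler_peMr// ler1n.
  have tnT n : t_ n < T by rewrite gtrBl divr_gt0.
  have t_inc N n : (N <= n)%N -> t_ N <= t_ n.
    move=> Nn; rewrite lerD2l lerN2 ler_wpM2l// lef_pV2 ?posrE//.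
    by rewrite ler_nat.
  have t_cvg : t_ @ \oo --> T.
    apply/cvgrPdist_lt => z z0; have zT : 0 < z / T by rewrite divr_gt0.
    apply: filterS (invS_lt zT) => n; rewrite ltr_pdivlMr// => h.
    by rewrite subKr gtr0_norm ?divr_gt0// mulrC.
  have [l el] : exists l : H, (e \o t_) @ \oo --> l.
    apply: cauchy_cvg_dist => z z0.
    have zT : 0 < z / (r / 2 * T) by rewrite divr_gt0// mulr_gt0.
    have [N _ /(_ N (leqnn N))/= Nz] := invS_lt zT.
    exists N => n Nn; rewrite distrC.
    rewrite (le_lt_trans (lip _ _ (tn0 N) (t_inc _ _ Nn) (tnT n)))//.
    rewrite ltr_pdivlMr ?mulr_gt0// in Nz; apply: le_lt_trans Nz.
    rewrite [leRHS]mulrCA ler_wpM2l ?(ltW r20)//.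
    by rewrite mulrC -[leRHS](subKr T) lerD2r ltW.
  have lr : `|x0 - l| < 2 * r.
    have /cvgrPdist_lt/(_ _ r20)[n _ /(_ n (leqnn n))/= ln] := el.
    rewrite -(subrKA (e 0)) (le_lt_trans (ler_normD _ _))//.
    rewrite -(subrKA (e (t_ n)) (e 0)).
    have h1 : `|x0 - e 0| < r.
      by rewrite /e /gam /y scale0r addr0 /y1 (chart_mapK (mem_set bq')).
    have := lip 0 (t_ n) (lexx 0) (tn0 n) (tnT n); rewrite subr0 distrC => h2.
    have h3 : r / 2 * t_ n <= r / 2.
      by rewrite ler_piMr ?(ltW r20)// (le_trans (ltW (tnT n))).
    have := ler_normD (e 0 - e (t_ n)) (e (t_ n) - l).
    by move: ln h1 h2 h3; rewrite (distrC l); lra.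
  have [/chart_codomP[al ail] _] := Ga _ (lt_trans lr rR).
  have T01 : 0 <= T <= 1 by rewrite T0.
  have gT : gam \o t_ @ \oo --> gam T.
    exact: (cvg_comp _ _ t_cvg (gam_cont T T01)).
  have gl : gam \o t_ @ \oo --> chart_inv a l.
    have -> : gam \o t_ = chart_inv a \o (e \o t_).
      apply/funext => n /=; have [an _] := below _ (tn0 n) (tnT n).
      by rewrite /e (chart_mapK (mem_set an)).
    apply: (cvg_comp _ _ el); apply: chart_inv_continuous.
    by exists (chart_inv a l).
  have gE : gam T = chart_inv a l by exact: (cvg_unique (riem_hausdorff X)) gT gl.
  by split; rewrite /e gE// ail.
have [T1'|TN1] := eqVneq T 1.
  have [+ _] := goodT; rewrite T1' /gam /y scale1r /u addrC subrK.
  by rewrite /y0 (chart_mapK (mem_set bq)).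
have T_lt1 : T < 1 by rewrite lt_neqAle TN1.
have T01 : 0 <= T <= 1 by rewrite T0.
have [v dv _] := de T T01 goodT.
have [aT eT] := goodT.
have nT : \forall t \near T, good t.
  apply: filterI.
    by apply: (gam_cont T T01); apply: open_nbhs_nbhs; split => //; exact: chart_dom_open.
  have eT0 : 0 < 2 * r - `|x0 - e T| by rewrite subr_gt0.
  have /cvgrPdist_lt/(_ _ eT0) := is_derive1_continuous dv.
  apply: filterS => t h; rewrite -(subrKA (e T)) (le_lt_trans (ler_normD _ _))//.
  by rewrite -ltrBrDl.
have /nbhs_ballP[z /= z0 zP] := nT.
pose t1 := Num.min 1 (T + z / 2).
have t1T : T < t1 by rewrite lt_min T_lt1 ltrDl divr_gt0.
have : S t1.
  split; first by rewrite (le_trans T0 (ltW t1T)) ge_min lexx.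
  move=> s /andP[s0 st]; have [sT|Ts] := ltP s T; first exact: below.
  apply: zP; rewrite -ball_normE/= distrC ger0_norm ?subr_ge0//.
  have : t1 <= T + z / 2 by rewrite ge_min lexx orbT.
  by move: st z0; lra.
by move/(ub_le_sup S_sup.2); rewrite leNgt -/T t1T.
Qed.

(** Being [C^1] is local: at a point of [chart_dom a] the chain rule applies to the chart
    transition, and near any other point the separation hypothesis makes the function vanish
    identically. *)
Lemma C1_extension_by_zero (a : chart H M) (psi : H -> R^o)
    (psi' : H -> 'L(H, R^o)) (x0 : H) (r : R) : atlas X a ->
  (forall x, is_diff x psi (psi' x)) -> continuous psi' ->
  (forall x, r <= `|x0 - x| -> psi x = 0 /\ psi' x = 0) ->
  (forall q, ~ chart_dom a q ->
    \forall q' \near q, chart_dom a q' -> r <= `|x0 - a q'|) ->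
  C1_function X (fun q => if `[< chart_dom a q >] then psi (a q) else 0).
Proof.
move=> Xa dpsi cpsi' psi0 sep b Xb.
set phi := (phi in phi \o chart_inv b).
pose T := chart_transition b a.
have [T' [dT cT']] := atlas_smooth Xb Xa 1.
pose f' y := if `[< chart_dom a (chart_inv b y) >]
  then contlin_comp (psi' (T y)) (T' y) else 0.
have local y : chart_codom b y -> exists F F',
    [/\ \forall z \near y, F z = (phi \o chart_inv b) z,
        \forall z \near y, F' z = f' z, is_diff y F (F' y : 'L(H, R^o)) &
        {for y, continuous F'}].
  move=> yb; have [by_ byy] := chart_codomP yb.
  have ci : {for y, continuous (chart_inv b)} by exact: chart_inv_continuous.
  have [ay|Nay] := pselect (chart_dom a (chart_inv b y)).
    have ov : chart_overlap b a y by exists (chart_inv b y).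
    have na : \forall z \near y, chart_dom a (chart_inv b z).
      by apply: ci; apply: open_nbhs_nbhs; split => //; exact: chart_dom_open.
    exists (psi \o T), (fun z => contlin_comp (psi' (T z)) (T' z)); split.
    - by apply: filterS na => z az /=; rewrite /phi asboolT.
    - by apply: filterS na => z az /=; rewrite /f' asboolT.
    - by have ? := dT y ov; have ? := dpsi (T y); exact: is_diff_comp.
    - apply: continuous_contlin_comp; last exact: cT'.
      apply: continuous_comp; last exact: cpsi'.
      by have := dT y ov => -[/differentiable_continuous].
  have nz : \forall z \near y, phi (chart_inv b z) = 0 /\ f' z = 0.
    have sepy : \forall z \near y, chart_dom a (chart_inv b z) ->
      r <= `|x0 - T z| := ci _ (sep _ Nay).
  apply: filterS sepy => z zr.
    rewrite /phi /f'; case: asboolP => // az.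
    have [-> ->] := psi0 _ (zr az); split => //.
    exact: contlin_ext.
  exists (cst 0), (cst 0); split.
  - by apply: filterS nz => z [].
  - by apply: filterS nz => z [].
  - exact: is_diff_cst.
  - exact: cvg_cst.
exists f'; split => y /local[F [F' [FE F'E dF cF']]].
  by apply: is_diff_eq_near FE _; rewrite -(nbhs_singleton F'E).
rewrite /prop_for /continuous_at -(nbhs_singleton F'E); apply: cvg_trans cF'.
exact: near_eq_cvg.
Qed.

Lemma convex_subdifferentiable (hilbertH : hilbert_space H) (g : M -> R) (p : M) :
  continuous g -> geodesically_convex X g -> subdifferentiable X g p.
Proof.
move=> cg g_convex; have [a Xa ap] := atlas_cover X p.
have ax0 : chart_codom a (a p) by exists p.
set x0 := a p in ax0; pose f := g \o chart_inv a.
have [rho [tau [N [rho0 tau0 N0 fc f_curve]]]] :=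
  convex_chart_curves hilbertH cg g_convex Xa ax0.
have f_cont x : `|x0 - x| < rho -> {for x, continuous f} by move=> /fc[].
have [r [L [K [r0 L0 K0 fL fK]]]] := curve_semiconvex rho0 tau0 N0 f_cont f_curve.
have [l lP] := semiconvex_support hilbertH r0 L0 K0 fL fK.
have [r1 r10 sep] := chart_separation hilbertH Xa ax0.
(* The support of the bump obeys the separation radius [r1]; the radius [r] of the support
   inequality only limits the neighbourhood of [p] on which the functions are compared. *)
have [psi [psi' [dpsi cpsi' psi0 [d d0 dP]]]] := touching_bump hilbertH l x0 K0 r10.
exists (fun q => if `[< chart_dom a q >] then psi (a q) else 0).
  exact: C1_extension_by_zero dpsi cpsi' psi0 sep.
have rd0 : 0 < Num.min r d by rewrite lt_min r0.
have na : \forall q \near p, chart_dom a q /\ `|x0 - a q| < Num.min r d.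
  apply: filterI; first by apply: open_nbhs_nbhs; split => //; exact: chart_dom_open.
  by have /cvgrPdist_lt := chart_map_continuous ap; apply.
apply: filterS na => q [aq]; rewrite distrC lt_min => /andP[qr qd].
rewrite !asboolT//; have := lP _ qr; have := dP _ (ltW qd).
rewrite addrC subrK /f /= !(chart_mapK (mem_set _))// -/x0.
move: (psi _ : R) (psi _ : R) (l _ : R) (K * _) => *; lra.
Qed.

End ManifoldGeodesics.

End Manifold.

Theorem theorem5p3 (R : realType) (H : completeNormedModType R)
    (hilbertH : hilbert_space H) (M : topologicalType) (X : riemannian H M)
    (g : M -> R) (g_continuous : continuous g)
    (g_convex : geodesically_convex X g) (p : M) :
  subdifferentiable X g p.
Proof. exact: convex_subdifferentiable. Qed.
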